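(* Let $(\mathcal{D},\epsilon)$ be a tensor manifold. The fusion operation is compatible with the tensor product: if $f,g\in Mor(\mathcal{D})$ and $I_1,O_1,I_2,O_2$ are linear partitions with $|dom(f)|=\|I_1\|$, $|cod(f)|=\|O_1\|$, $|dom(g)|=\|I_2\|$ and $|cod(g)|=\|O_2\|$, then $$\ast^{I_1\otimes I_2}_{O_1\otimes O_2}(f\otimes_\epsilon g)=\ast^{I_1}_{O_1}(f)\otimes_\epsilon\ast^{I_2}_{O_2}(g).$$
   Context: Planar graphs. A graph is a triple $(H,P,\sigma)$ with $H$ a finite set (half-edges), $P$ a partition of $H$ into nonempty blocks (vertices), $\sigma$ an involution of $H$ (its orbits are the edges), such that a vertex containing a two-element $\sigma$-orbit equals that orbit; such vertices and edges are called virtual, all other vertices real. A leg is a half-edge fixed by $\sigma$ (real leg) or lying in a virtual edge (virtual leg). An orientation $\mathrm{sgn}:H\to\{+,-\}$ takes different values on the two elements of each two-element orbit; $In(v),Out(v)$ (resp. $In(\Gamma),Out(\Gamma)$) are the sets of half-edges in $v$ (resp. of legs) of sign $+$, $-$. The graph is directed if all $In(v),Out(v)$ are nonempty. The source (target) of an edge is the vertex containing its $-$ ($+$) half-edge, if there is one; $e\to e'$ means there are edges $e=e_1,\dots,e_n=e'$, $n\ge 1$, with the target of $e_i$ equal to the source of $e_{i+1}$. A planar graph is a directed graph with a linear order $\prec$ on its edges such that for all distinct edges: $e_1\to e_2$ implies $e_1\prec e_2$; and if $e_1\to e_2$ and $e_1\prec e_3\prec e_2$ then $e_1\to e_3$ or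 $e_3\to e_2$. The sets $In(\cdot)$, $Out(\cdot)$ are ordered by $\prec$ applied to the edges containing their elements. A graph is unitary if it consists of exactly one virtual vertex; prime if it has exactly one vertex and is not unitary. $\Gamma_1\otimes\Gamma_2$ is the disjoint union, with all edges of $\Gamma_1$ preceding those of $\Gamma_2$. If $Out(\Gamma_1)=\{o_1,\dots,o_n\}$ and $In(\Gamma_2)=\{i_1,\dots,i_n\}$ in increasing order, $\Gamma_2\circ\Gamma_1$ is obtained from the disjoint union by grafting $o_k$ to $i_k$ for each $k$: if both are real legs, join them into an edge $\bar e_k=\{o_k,i_k\}$; if exactly one is virtual, delete its virtual edge, the edge of the other being $\bar e_k$; if both are virtual, delete $o_k,i_k$ and let $\bar e_k=\{\sigma_1(o_k),\sigma_2(i_k)\}$ be a virtual edge (and a virtual vertex). The order of edges is $A_1,\bar e_1,B_1,\dots,A_n,\bar e_n,B_n$, where $A_k$ is the set of edges of $\Gamma_1$ strictly between the edges of $o_{k-1}$ and $o_k$ (before that of $o_1$ if $k=1$) and $B_k$ the set of edges of $\Gamma_2$ strictly between the edges of $i_k$ and $i_{k+1}$ (after that of $i_n$ if $k=n$), each with its own order. Tensor manifolds. $W(S)$ is the set of words (including the empty one) in $S$. A tensor scheme $\mathcal{D}$ consists of sets $Ob(\mathcal{D})$, $Mor(\mathcal{D})$ and maps $s,t:Mor(\mathcal{D})\to W(Ob(\mathcal{D}))$ (also written $dom,cod$) whose values are nonempty words; morphisms of tensor schemes are pairs of maps $(\varphi_o,\varphi_m)$ compatible with $s,t$. $|w|$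 is the length of a word $w$. A diagram in $\mathcal{D}$ is a planar graph $\Gamma$ with a $\sigma$-invariant map $\gamma_o$ from half-edges to $Ob(\mathcal{D})$ and a map $\gamma_m$ from real vertices to $Mor(\mathcal{D})$ such that $s(\gamma_m(v))$, $t(\gamma_m(v))$ are the words of values of $\gamma_o$ along $In(v)$, $Out(v)$; its domain and codomain are the words along $In(\Gamma)$, $Out(\Gamma)$. Diagrams are taken up to bijections of half-edges preserving all structure; tensor product and composition are those of planar graphs with inherited decorations; they form a strict monoidal category $F(\mathcal{D})$ with objects $W(Ob(\mathcal{D}))$ under concatenation, identities being tensor products of unitary diagrams. $T(\mathcal{D})$ is the tensor scheme with $Ob(T(\mathcal{D}))=W(Ob(\mathcal{D}))$ whose morphisms are bracketed diagrams $(w_1\cdots w_m;u_1\cdots u_n;\Gamma)$, $m,n\ge1$, with $w_i,u_j\in W(Ob(\mathcal{D}))$ and $\Gamma$ a diagram in $\mathcal{D}$ with domain the concatenation of the $w_i$ and codomain that of the $u_j$; source $w_1\cdots w_m$, target $u_1\cdots u_n$ (words in words). $T$ acts on morphisms by relabelling. $\eta_{\mathcal{D}}:\mathcal{D}\to T(\mathcal{D})$ sends $x$ to the one-letter word $(x)$ and $f:x_1\cdots x_m\to y_1\cdots y_n$ to $((x_1)\cdots(x_m);(y_1)\cdots(y_n);\Gamma_f)$, with $\Gamma_f$ the prime diagram with vertex decorated by $f$. $\mu_{\mathcal{D}}:TT(\mathcal{D})\to T(\mathcal{D})$ concatenates words of words and sends a bracketed diagram $\Delta$ in $T(\mathcal{D})$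 to its value in $F(\mathcal{D})$ (the diagram in $\mathcal{D}$ obtained by tensoring and composing, as prescribed by $\Delta$, the diagrams decorating its vertices), each bracket being concatenated. A tensor manifold is an algebra $(\mathcal{D},\epsilon)$ of the monad $(T,\mu,\eta)$: a morphism of tensor schemes $\epsilon=(\epsilon_o,\epsilon_m):T(\mathcal{D})\to\mathcal{D}$ with $\epsilon\circ T(\epsilon)=\epsilon\circ\mu_{\mathcal{D}}$ and $\epsilon\circ\eta_{\mathcal{D}}=Id$. Operations. For $f:x_1\cdots x_m\to y_1\cdots y_n$ and $g:u_1\cdots u_k\to v_1\cdots v_l$ in $\mathcal{D}$, $f\otimes_\epsilon g=\epsilon_m\big((x_1)\cdots(x_m)(u_1)\cdots(u_k);(y_1)\cdots(y_n)(v_1)\cdots(v_l);\Gamma_f\otimes\Gamma_g\big)$, with one-letter brackets. A linear partition is a partition of a finite linearly ordered set into nonempty consecutive segments (blocks), which are linearly ordered; $\|I\|$ is the number of elements of the underlying set; $I\otimes J$ is the linear partition of the ordered concatenation of the underlying sets whose blocks are those of $I$ followed by those of $J$. For linear partitions $I,O$ with $m=\|I\|$, $n=\|O\|$, $\ast^I_O(f)=\epsilon_m$ of the prime diagram $\Gamma_f$ with domain $x_1\cdots x_m$ and codomain $y_1\cdots y_n$ bracketed into consecutive words according to $I$ and $O$. *)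

(* Defs.v *)
From mathcomp Require Import all_boot.
Set Implicit Arguments. Unset Strict Implicit. Unset Printing Implicit Defensive.

(* The data of an oriented graph with a relation on its edges.  [true] is the
   sign +.  An edge is represented by any of its half-edges: [prec h h'] reads
   "the edge of h strictly precedes the edge of h'".  The axioms are in
   [planar_graph]. *)
Record pregraph := PreGraph {
  hedge : finType;
  verts : {set {set hedge}};
  sigma : hedge -> hedge;
  sgn : hedge -> bool;
  prec : rel hedge
}.

Definition edge (G : pregraph) (h : hedge G) : {set hedge G} :=
  [set h; sigma h].

Definition virtual_vertex (G : pregraph) (v : {set hedge G}) : bool :=
  (v \in verts G) && [exists h, (sigma h != h) && (v == edge h)].

Definition real_vertex (G : pregraph) (v : {set hedge G}) : bool :=
  (v \in verts G) && ~~ virtual_vertex v.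

(* [h] lies in a virtual edge *)
Definition virtual (G : pregraph) (h : hedge G) : bool :=
  (sigma h != h) && (edge h \in verts G).

Definition leg (G : pregraph) (h : hedge G) : bool :=
  (sigma h == h) || virtual h.

Definition vin (G : pregraph) (v : {set hedge G}) : {set hedge G} :=
  [set h in v | sgn h].
Definition vout (G : pregraph) (v : {set hedge G}) : {set hedge G} :=
  [set h in v | ~~ sgn h].
Definition gin (G : pregraph) : {set hedge G} := [set h | leg h && sgn h].
Definition gout (G : pregraph) : {set hedge G} := [set h | leg h && ~~ sgn h].

Definition same_vertex (G : pregraph) (h h' : hedge G) : bool :=
  h' \in pblock (verts G) h.

(* the target of the edge of [h] exists and is the source of the edge of [h'] *)
Definition edge_step (G : pregraph) (h h' : hedge G) : bool :=
  [exists a in edge h, exists b in edge h',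
    [&& sgn a, ~~ sgn b & same_vertex a b]].

Definition leads (G : pregraph) (h h' : hedge G) : bool :=
  (h' \in edge h) || connect (@edge_step G) h h'.

(* the elements of [A] in increasing order of their edges *)
Definition ordered (G : pregraph) (A : {set hedge G}) : seq (hedge G) :=
  sort (fun h h' => ~~ prec h' h) (enum A).

Definition ins (G : pregraph) : seq (hedge G) := ordered (gin G).
Definition outs (G : pregraph) : seq (hedge G) := ordered (gout G).

Record is_graph (G : pregraph) : Prop := IsGraph {
  verts_partition : partition (verts G) [set: hedge G];
  sigma_involutive : involutive (@sigma G);
  edge_in_vertex : forall v (h : hedge G),
    v \in verts G -> h \in v -> sigma h \in v -> sigma h != h -> v = edge h
}.

Definition is_orientation (G : pregraph) : Prop :=
  forall h : hedge G, sigma h != h -> sgn (sigma h) = ~~ sgn h.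

Definition is_directed (G : pregraph) : Prop :=
  forall v : {set hedge G}, v \in verts G ->
    (vin v != set0) && (vout v != set0).

(* [prec] is (induced by) a strict linear order on the set of edges *)
Record is_edge_order (G : pregraph) : Prop := IsEdgeOrder {
  prec_sigmal : forall h h' : hedge G, prec (sigma h) h' = prec h h';
  prec_sigmar : forall h h' : hedge G, prec h (sigma h') = prec h h';
  prec_irr : irreflexive (@prec G);
  prec_trans : transitive (@prec G);
  prec_total : forall h h' : hedge G,
    h' \notin edge h -> prec h h' || prec h' h
}.

Record planar_graph (G : pregraph) : Prop := PlanarGraph {
  planar_is_graph : is_graph G;
  planar_orientation : is_orientation G;
  planar_directed : is_directed G;
  planar_edge_order : is_edge_order G;
  planar_leads_prec : forall h1 h2 : hedge G,
    h2 \notin edge h1 -> leads h1 h2 -> prec h1 h2;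
  planar_between : forall h1 h2 h3 : hedge G,
    leads h1 h2 -> prec h1 h3 -> prec h3 h2 -> leads h1 h3 || leads h3 h2
}.

Definition empty_graph : pregraph :=
  @PreGraph void set0 id (fun _ => true) (fun _ _ => false).

Definition unitary_graph : pregraph :=
  @PreGraph bool [set [set: bool]] negb id (fun _ _ => false).

Definition prime_graph (m n : nat) : pregraph :=
  @PreGraph ('I_m + 'I_n)%type [set [set: 'I_m + 'I_n]] id
    (fun h => if h is inl _ then true else false)
    (fun h h' => match h, h' with
       | inl i, inl j => i < j
       | inl _, inr _ => true
       | inr _, inl _ => false
       | inr i, inr j => i < j
       end).

Definition tensor_graph (G1 G2 : pregraph) : pregraph :=
  @PreGraph (hedge G1 + hedge G2)%type
    ([set inl @: v | v : {set hedge G1} in verts G1] :|: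
     [set inr @: v | v : {set hedge G2} in verts G2])
    (fun h => match h with inl a => inl (sigma a) | inr b => inr (sigma b) end)
    (fun h => match h with inl a => sgn a | inr b => sgn b end)
    (fun h h' => match h, h' with
       | inl a, inl a' => prec a a'
       | inl _, inr _ => true
       | inr _, inl _ => false
       | inr b, inr b' => prec b b'
       end).

(* Composition [G2 o G1].  [graft_out o_k = Some i_k], [graft_in i_k = Some o_k],
   and both are [None] on the half-edges that are not grafted, provided that
   [outs G1] and [ins G2] have the same length. *)
Definition graft_out (G1 G2 : pregraph) (o : hedge G1) : option (hedge G2) :=
  onth (ins G2) (index o (outs G1)).
Definition graft_in (G1 G2 : pregraph) (i : hedge G2) : option (hedge G1) :=
  onth (outs G1) (index i (ins G2)).

(* A virtual edge {o_k, sigma o_k} of [G1] is deleted, except that sigma o_k is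
   kept if i_k is virtual too; symmetrically for [G2]. *)
Definition comp_kept (G1 G2 : pregraph) (h : hedge G1 + hedge G2) : bool :=
  match h with
  | inl a => virtual a ==>
      (if @graft_out G1 G2 (sigma a) is Some i then virtual i else false)
  | inr b => virtual b ==>
      (if @graft_in G1 G2 (sigma b) is Some o then virtual o else false)
  end.

Definition comp_sigma (G1 G2 : pregraph) (h : hedge G1 + hedge G2) :
    hedge G1 + hedge G2 :=
  match h with
  | inl a =>
      if virtual a then
        (* a = sigma o_k with o_k and i_k virtual *)
        if @graft_out G1 G2 (sigma a) is Some i then inr (sigma i) else inl a
      else if @graft_out G1 G2 a is Some i then
        (* a = o_k is a real leg *)
        if virtual i then inl a else inr i
      else inl (sigma a)
  | inr b =>
      if virtual b then
        if @graft_in G1 G2 (sigma b) is Some o then inl (sigma o) else inr b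
      else if @graft_in G1 G2 b is Some o then
        if virtual o then inr b else inl o
      else inr (sigma b)
  end.

(* The vertices of the disjoint union, and the new virtual vertices
   {sigma o_k, sigma i_k}. *)
Definition comp_same_vertex (G1 G2 : pregraph) (h h' : hedge G1 + hedge G2) :
    bool :=
  let bridge (a : hedge G1) (b : hedge G2) :=
    [&& virtual a, virtual b & graft_out G2 (sigma a) == Some (sigma b)] in
  match h, h' with
  | inl a, inl a' => same_vertex a a'
  | inl a, inr b => bridge a b
  | inr b, inl a => bridge a b
  | inr b, inr b' => same_vertex b b'
  end.

(* Position in A_0, e_0, B_0, A_1, e_1, B_1, ... (numbering from 0): the block
   A_k has rank 3k, the grafted edge e_k has rank 3k+1, and B_k has rank 3k+2.
   For an edge of A_k or e_k, k is the number of o_j that precede it strictly;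
   for an edge of e_k or B_k, k+1 is the number of i_j that precede it weakly. *)
Definition comp_rank (G1 G2 : pregraph) (h : hedge G1 + hedge G2) : nat :=
  match h with
  | inl a => 3 * count (fun o => prec o a) (outs G1)
             + (if has (mem (edge a)) (outs G1) then 1 else 0)
  | inr b => 3 * (count (fun i => ~~ prec b i) (ins G2)).-1
             + (if has (mem (edge b)) (ins G2) then 1 else 2)
  end.

Definition comp_prec (G1 G2 : pregraph) (h h' : hedge G1 + hedge G2) : bool :=
  (comp_rank h < comp_rank h') ||
  (comp_rank h == comp_rank h') &&
  match h, h' with
  | inl a, inl a' => prec a a'
  | inr b, inr b' => prec b b'
  | _, _ => false
  end.

Definition comp_half (G1 G2 : pregraph) : finType :=
  {h : hedge G1 + hedge G2 | comp_kept h}.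

Definition comp_graph (G2 G1 : pregraph) : pregraph :=
  @PreGraph (comp_half G1 G2)
    (equivalence_partition
       (fun h h' : comp_half G1 G2 => comp_same_vertex (val h) (val h')) setT)
    (fun h => insubd h (comp_sigma (val h)))
    (fun h => match val h with inl a => sgn a | inr b => sgn b end)
    (fun h h' => comp_prec (val h) (val h')).

Record tensor_scheme := TensorScheme {
  Ob : Type;
  Mor : Type;
  dom : Mor -> seq Ob;
  cod : Mor -> seq Ob;
  dom_nonempty : forall f : Mor, 0 < size (dom f);
  cod_nonempty : forall f : Mor, 0 < size (cod f)
}.

Record scheme_hom (D D' : tensor_scheme) := SchemeHom {
  hom_o : Ob D -> Ob D';
  hom_m : Mor D -> Mor D';
  hom_dom : forall f, dom (hom_m f) = map hom_o (dom f);
  hom_cod : forall f, cod (hom_m f) = map hom_o (cod f)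
}.

(* [dec_m] is a partial map on sets of half-edges, defined exactly on the real
   vertices of a diagram (see [is_diagram]). *)
Record prediagram (D : tensor_scheme) := PreDiagram {
  graph_of :> pregraph;
  dec_o : hedge graph_of -> Ob D;
  dec_m : {set hedge graph_of} -> option (Mor D)
}.

Definition word_along (D : tensor_scheme) (G : prediagram D)
    (A : {set hedge G}) : seq (Ob D) :=
  map (@dec_o D G) (ordered A).

Definition gdom (D : tensor_scheme) (G : prediagram D) : seq (Ob D) :=
  word_along (gin G).
Definition gcod (D : tensor_scheme) (G : prediagram D) : seq (Ob D) :=
  word_along (gout G).

Record is_diagram (D : tensor_scheme) (G : prediagram D) : Prop := IsDiagram {
  diagram_planar : planar_graph G;
  diagram_sigma : forall h : hedge G, dec_o (sigma h) = dec_o h;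
  diagram_real : forall v : {set hedge G}, isSome (dec_m v) = real_vertex v;
  diagram_word : forall (v : {set hedge G}) f, dec_m v = Some f ->
    dom f = word_along (vin v) /\ cod f = word_along (vout v)
}.

Definition diagram_iso (D : tensor_scheme) (G G' : prediagram D) : Prop :=
  exists phi : hedge G -> hedge G',
    [/\ bijective phi,
        verts G' = [set phi @: v | v : {set hedge G} in verts G],
        (forall h, phi (sigma h) = sigma (phi h)) /\
          (forall h, sgn (phi h) = sgn h),
        (forall h h', prec (phi h) (phi h') = prec h h') &
        (forall h, dec_o (phi h) = dec_o h) /\
          (forall v : {set hedge G}, dec_m (phi @: v) = dec_m v)].

Definition empty_diagram (D : tensor_scheme) : prediagram D :=
  @PreDiagram D empty_graph (fun h : void => match h with end) (fun _ => None).

Definition unitary_diagram (D : tensor_scheme) (x : Ob D) : prediagram D :=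
  @PreDiagram D unitary_graph (fun _ => x) (fun _ => None).

Definition prime_diagram (D : tensor_scheme) (f : Mor D) : prediagram D :=
  @PreDiagram D (prime_graph (size (dom f)) (size (cod f)))
    (fun h => match h with
       | inl i => tnth (in_tuple (dom f)) i
       | inr j => tnth (in_tuple (cod f)) j
       end)
    (fun v => if v == setT then Some f else None).

(* The decoration of a set of half-edges of a disjoint union that lies in one
   of the two summands; no real vertex meets both. *)
Definition sum_dec_m (D : tensor_scheme) (G1 G2 : prediagram D)
    (v : {set hedge G1 + hedge G2}) : option (Mor D) :=
  let v1 := [set a | inl a \in v] in
  let v2 := [set b | inr b \in v] in
  if v2 == set0 then dec_m v1 else if v1 == set0 then dec_m v2 else None.

Definition sum_dec_o (D : tensor_scheme) (G1 G2 : prediagram D)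
    (h : hedge G1 + hedge G2) : Ob D :=
  match h with inl a => dec_o a | inr b => dec_o b end.

Definition tensor (D : tensor_scheme) (G1 G2 : prediagram D) : prediagram D :=
  @PreDiagram D (tensor_graph G1 G2)
    (@sum_dec_o D G1 G2) (@sum_dec_m D G1 G2).

Definition compose (D : tensor_scheme) (G2 G1 : prediagram D) : prediagram D :=
  @PreDiagram D (comp_graph G2 G1)
    (fun h => @sum_dec_o D G1 G2 (val h))
    (fun v => @sum_dec_m D G1 G2 (val @: v)).

Definition identity_diagram (D : tensor_scheme) (w : seq (Ob D)) :
    prediagram D :=
  foldr (fun x G => tensor (unitary_diagram x) G) (empty_diagram D) w.

Definition relabel (D D' : tensor_scheme) (phi : scheme_hom D D')
    (G : prediagram D) : prediagram D' :=
  @PreDiagram D' G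
    (fun h => hom_o phi (dec_o h)) (fun v => omap (hom_m phi) (dec_m v)).

Lemma diagram_iso_refl (D : tensor_scheme) (G : prediagram D) :
  diagram_iso G G.
Proof.
exists id; split=> //; first by exists id.
- by rewrite -[LHS]imset_id; apply: eq_imset => v; rewrite imset_id.
- by split=> // v; rewrite imset_id.
Qed.

Lemma diagram_iso_trans (D : tensor_scheme) (G1 G2 G3 : prediagram D) :
  diagram_iso G1 G2 -> diagram_iso G2 G3 -> diagram_iso G1 G3.
Proof.
move=> [f [bf vf [sf gf] pf [of_ mf]]] [g [bg vg [sg gg] pg [og mg]]].
exists (g \o f); split=> /=.
- exact: bij_comp.
- by rewrite vg vf -imset_comp; apply: eq_imset => v /=; rewrite imset_comp.
- by split=> h; rewrite ?sf ?sg // gg gf.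
- by move=> h h'; rewrite pg pf.
- by split=> [h|v]; rewrite ?og ?of_ // imset_comp mg mf.
Qed.

Lemma diagram_iso_sym (D : tensor_scheme) (G1 G2 : prediagram D) :
  diagram_iso G1 G2 -> diagram_iso G2 G1.
Proof.
move=> [f [[g fK gK] vf [sf gf] pf [of_ mf]]].
have fgI (v : {set hedge G2}) : f @: (g @: v) = v.
  by rewrite -imset_comp -[RHS]imset_id; apply: eq_imset => h /=; apply: gK.
have gfI (v : {set hedge G1}) : g @: (f @: v) = v.
  by rewrite -imset_comp -[RHS]imset_id; apply: eq_imset => h /=; apply: fK.
exists g; split.
- by exists f.
- rewrite vf -imset_comp -[LHS]imset_id; apply: eq_imset => v /=.
  by rewrite gfI.
- split=> h; first by rewrite -{1}[h]gK -sf fK.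
  by rewrite -{2}[h]gK gf.
- by move=> h h'; rewrite -pf !gK.
- by split=> [h|v]; [rewrite -of_ gK|rewrite -mf fgI].
Qed.

Lemma relabel_iso (D D' : tensor_scheme) (phi : scheme_hom D D')
    (G1 G2 : prediagram D) :
  diagram_iso G1 G2 -> diagram_iso (relabel phi G1) (relabel phi G2).
Proof.
move=> [f [bf vf sf pf [of_ mf]]]; exists f; split=> //.
by split=> [h|v] /=; rewrite ?of_ ?mf.
Qed.

Lemma relabel_word (D D' : tensor_scheme) (phi : scheme_hom D D')
    (G : prediagram D) (A : {set hedge G}) :
  @word_along D' (relabel phi G) A = map (hom_o phi) (word_along A).
Proof. by rewrite /word_along -map_comp. Qed.

Lemma relabel_diagram (D D' : tensor_scheme) (phi : scheme_hom D D')
    (G : prediagram D) : is_diagram G -> is_diagram (relabel phi G).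
Proof.
move=> [pl so re wo]; split=> //.
- by move=> h /=; rewrite so.
- by move=> v; rewrite -[RHS](re v) /=; case: (@dec_m D G v).
- move=> v f /=; case E: (@dec_m D G v) => [f0|] //= [<-].
  by rewrite !relabel_word hom_dom hom_cod; have [-> ->] := wo _ _ E.
Qed.

Lemma mem_ordered (G : pregraph) (A : {set hedge G}) : ordered A =i A.
Proof. by move=> h; rewrite mem_sort mem_enum. Qed.

Lemma ordered_sorted (G : pregraph) (A : {set hedge G}) :
  is_edge_order G -> {in A &, forall h h', h' \in edge h -> h' = h} ->
  sorted (@prec G) (ordered A).
Proof.
move=> oG sepA; set le := fun h h' : hedge G => ~~ prec h' h.
have le_total : total le.
  move=> h h'; rewrite /le -negb_and; apply/negP => /andP[p q].
  by have := prec_trans oG p q; rewrite (prec_irr oG).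
have le_trans : transitive le.
  move=> y x z; rewrite /le => yx zy; apply/negP => zx.
  have [yz|yz] := boolP (y \in edge z).
    case/set2P: yz yx => ->; first by rewrite zx.
    by rewrite (prec_sigmal oG) zx.
  have := prec_total oG yz; rewrite (negPf zy) /= => p.
  by rewrite (prec_trans oG p zx) in yx.
have s1 : pairwise le (ordered A).
  by rewrite -(sorted_pairwise le_trans); apply: sort_sorted.
have s2 : pairwise (fun x y => x != y) (ordered A).
  by rewrite -uniq_pairwise sort_uniq enum_uniq.
apply: pairwise_sorted.
have : pairwise [rel x y | le x y && (x != y)] (ordered A).
  by rewrite pairwise_relI s1 s2.
apply: (@sub_in_pairwise _ (mem A)); last first.
  by apply/allP => h; rewrite mem_ordered.
move=> x y xA yA /= /andP[lxy nxy].
have : y \notin edge x by apply: contra nxy => /(sepA _ _ xA yA) ->.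
by move/(prec_total oG); rewrite (negPf lxy) orbF.
Qed.

Lemma ordered_eq (G : pregraph) (A : {set hedge G}) (s : seq (hedge G)) :
  is_edge_order G -> {in A &, forall h h', h' \in edge h -> h' = h} ->
  sorted (@prec G) s -> s =i A -> ordered A = s.
Proof.
move=> oG sepA ss sA.
apply: (irr_sorted_eq (prec_trans oG) (prec_irr oG)) => //.
  exact: ordered_sorted.
by move=> h; rewrite mem_ordered sA.
Qed.

Lemma sgn_separated (G : pregraph) (A : {set hedge G}) (b : bool) :
  is_orientation G -> {in A, forall h, sgn h = b} ->
  {in A &, forall h h', h' \in edge h -> h' = h}.
Proof.
move=> oG sA h h' hA h'A /set2P[] // e; rewrite e in h'A *.
have [//|n] := eqVneq (sigma h) h.
by have := oG _ n; rewrite (sA _ hA) (sA _ h'A); case: (b).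
Qed.

Lemma vin_separated (G : pregraph) (v : {set hedge G}) : is_orientation G ->
  {in vin v &, forall h h', h' \in edge h -> h' = h}.
Proof.
by move=> oG; apply: (@sgn_separated _ _ true) => // h; rewrite inE => /andP[].
Qed.
Lemma vout_separated (G : pregraph) (v : {set hedge G}) : is_orientation G ->
  {in vout v &, forall h h', h' \in edge h -> h' = h}.
Proof.
move=> oG; apply: (@sgn_separated _ _ false) => // h.
by rewrite inE => /andP[_ /negPf].
Qed.
Lemma gin_separated (G : pregraph) : is_orientation G ->
  {in gin G &, forall h h', h' \in edge h -> h' = h}.
Proof.
by move=> oG; apply: (@sgn_separated _ _ true) => // h; rewrite inE => /andP[].
Qed.
Lemma gout_separated (G : pregraph) : is_orientation G ->
  {in gout G &, forall h h', h' \in edge h -> h' = h}.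
Proof.
move=> oG; apply: (@sgn_separated _ _ false) => // h.
by rewrite inE => /andP[_ /negPf].
Qed.

Lemma prime_edge_order (m n : nat) : is_edge_order (prime_graph m n).
Proof.
split=> //.
- by case=> i /=; rewrite ltnn.
- by case=> y [] x [] z //=; apply: ltn_trans.
- case=> i [] j //=; rewrite !inE orbb => ne; rewrite -neq_ltn.
  + by apply: contra ne => /eqP/val_inj ->.
  + by apply: contra ne => /eqP/val_inj ->.
Qed.

Lemma prime_leads (m n : nat) (h h' : hedge (prime_graph m n)) :
  leads h h' = match h, h' with
    | inl i, inl j | inr i, inr j => i == j :> nat
    | inl _, inr _ => true
    | inr _, inl _ => false
    end.
Proof.
have pb (x : hedge (prime_graph m n)) : pblock (verts (prime_graph m n)) x = setT.
  apply: def_pblock; rewrite ?inE //.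
  by apply/trivIsetP => A B /set1P-> /set1P->; rewrite eqxx.
have stepE (x y : hedge (prime_graph m n)) :
    edge_step x y = (if x is inl _ then if y is inr _ then true else false
                     else false).
  apply/idP/idP; last first.
    case: x y => // i [] // j _.
    apply/existsP; exists (inl i); rewrite !inE eqxx /=.
    by apply/existsP; exists (inr j); rewrite !inE eqxx /= /same_vertex pb inE.
  case/existsP => a /andP[]; rewrite !inE orbb => /eqP ->.
  case/existsP => b /andP[]; rewrite !inE orbb => /eqP -> /and3P[].
  by case: x y => ? [].
have connE (x y : hedge (prime_graph m n)) :
    connect (@edge_step (prime_graph m n)) x y = (x == y) || edge_step x y.
  apply/idP/idP; last first.
    by case/orP => [/eqP->|/connect1 //]; apply: connect0.
  case/connectP => [[|z [|t p]]] /=.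
  - by move=> _ ->; rewrite eqxx.
  - by rewrite andbT => s ->; rewrite s orbT.
  - by rewrite !stepE; case: x z => ? [] ?.
rewrite /leads connE stepE !inE orbb [h' == h]eq_sym orbA orbb.
by case: h h' => i [] j; rewrite ?orbT ?orbF.
Qed.

Lemma prime_real (m n : nat) (v : {set hedge (prime_graph m n)}) :
  real_vertex v = (v == setT).
Proof.
rewrite /real_vertex /virtual_vertex inE.
case: eqP => //= _; rewrite -[RHS]/(~~ false); congr (~~ _).
by apply/existsP => -[h]; rewrite /= eqxx.
Qed.

Lemma prime_planar (m n : nat) : 0 < m -> 0 < n -> planar_graph (prime_graph m n).
Proof.
move=> m0 n0; split.
- split=> //=.
  + apply/and3P; split.
    * by rewrite /cover big_set1.
    * by apply/trivIsetP => A B /set1P-> /set1P->; rewrite eqxx.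
    * rewrite inE eq_sym; apply/set0Pn; exists (inl (Ordinal m0)).
      by rewrite inE.
  + by move=> v h _ _ _; rewrite eqxx.
- by move=> h; rewrite /= eqxx.
- move=> v /set1P ->; apply/andP; split; apply/set0Pn.
  + by exists (inl (Ordinal m0)); rewrite !inE.
  + by exists (inr (Ordinal n0)); rewrite !inE.
- exact: prime_edge_order.
- move=> h h'; rewrite prime_leads !inE orbb.
  by case: h h' => i [] j //= /negP ne /eqP/val_inj e; case: ne; rewrite e.
- move=> h1 h2 h3; rewrite !prime_leads.
  by case: h1 h2 h3 => [i|i] [j|j] [k|k] //=; rewrite ?orbT // => /eqP e l1 l2;
    move: (ltn_trans l1 l2); rewrite e ltnn.
Qed.

Lemma prime_orientation (m n : nat) : is_orientation (prime_graph m n).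
Proof. by move=> h /=; rewrite eqxx. Qed.

Lemma prime_ordered_in (m n : nat) (A : {set hedge (prime_graph m n)}) :
  A = [set h | sgn h] -> ordered A = map inl (enum 'I_m).
Proof.
move=> AE; apply: ordered_eq.
- exact: prime_edge_order.
- by move=> h h' _ _; rewrite !inE orbb => /eqP.
- rewrite sorted_map.
  by have := iota_ltn_sorted 0 m; rewrite -val_enum_ord sorted_map.
- move=> h; rewrite AE inE; case: h => i.
    by rewrite mem_map ?mem_enum //; apply: inl_inj.
  by apply/mapP => -[].
Qed.

Lemma prime_ordered_out (m n : nat) (A : {set hedge (prime_graph m n)}) :
  A = [set h | ~~ sgn h] -> ordered A = map inr (enum 'I_n).
Proof.
move=> AE; apply: ordered_eq.
- exact: prime_edge_order.
- by move=> h h' _ _; rewrite !inE orbb => /eqP.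
- rewrite sorted_map.
  by have := iota_ltn_sorted 0 n; rewrite -val_enum_ord sorted_map.
- move=> h; rewrite AE inE; case: h => i; last first.
    by rewrite mem_map ?mem_enum //; apply: inr_inj.
  by apply/mapP => -[].
Qed.

Lemma map_tnth_in_tuple (T : Type) (s : seq T) :
  map (tnth (in_tuple s)) (enum 'I_(size s)) = s.
Proof. exact: (map_tnth_enum (in_tuple s)). Qed.

Lemma prime_gdom (D : tensor_scheme) (f : Mor D) :
  gdom (prime_diagram f) = dom f.
Proof.
rewrite /gdom /word_along (@prime_ordered_in (size (dom f)) (size (cod f))).
  by rewrite -map_comp map_tnth_in_tuple.
by apply/setP=> h; rewrite !inE /leg eqxx.
Qed.

Lemma prime_gcod (D : tensor_scheme) (f : Mor D) :
  gcod (prime_diagram f) = cod f.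
Proof.
rewrite /gcod /word_along (@prime_ordered_out (size (dom f)) (size (cod f))).
  by rewrite -map_comp map_tnth_in_tuple.
by apply/setP=> h; rewrite !inE /leg eqxx.
Qed.

Lemma prime_diagram_ok (D : tensor_scheme) (f : Mor D) :
  is_diagram (prime_diagram f).
Proof.
split=> //.
- exact: prime_planar (dom_nonempty f) (cod_nonempty f).
- by move=> v /=; rewrite (@prime_real (size (dom f)) (size (cod f))); case: ifP.
- move=> v g /=; case: eqP => // -> [<-]; rewrite /word_along; split.
  + rewrite (@prime_ordered_in (size (dom f)) (size (cod f))).
      by rewrite -map_comp map_tnth_in_tuple.
    by apply/setP=> h; rewrite !inE.
  + rewrite (@prime_ordered_out (size (dom f)) (size (cod f))).
      by rewrite -map_comp map_tnth_in_tuple.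
    by apply/setP=> h; rewrite !inE.
Qed.

Record embedding (G1 G2 : pregraph) (phi : hedge G1 -> hedge G2) : Prop :=
  Embedding {
    emb_inj : injective phi;
    emb_sigma : forall h, phi (sigma h) = sigma (phi h);
    emb_sgn : forall h, sgn (phi h) = sgn h;
    emb_prec : forall h h', prec (phi h) (phi h') = prec h h';
    emb_block : forall h, pblock (verts G2) (phi h) = phi @: pblock (verts G1) h
  }.

Lemma mem_block (G : pregraph) (h : hedge G) :
  is_graph G -> h \in pblock (verts G) h.
Proof.
by move=> gG; rewrite mem_pblock (cover_partition (verts_partition gG)) inE.
Qed.

Lemma block_vert (G : pregraph) (h : hedge G) :
  is_graph G -> pblock (verts G) h \in verts G.
Proof.
move=> gG; apply: pblock_mem.
by rewrite (cover_partition (verts_partition gG)) inE.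
Qed.

Lemma vert_blockE (G : pregraph) (h : hedge G) (v : {set hedge G}) :
  is_graph G -> h \in v -> (v \in verts G) = (pblock (verts G) h == v).
Proof.
move=> gG hv; apply/idP/eqP => [vG|<-]; last exact: block_vert.
by case/and3P: (verts_partition gG) => _ tG _; apply: def_pblock.
Qed.

Lemma virtualE (G : pregraph) (h : hedge G) :
  is_graph G -> virtual h = (sigma h != h) && (pblock (verts G) h == edge h).
Proof.
by move=> gG; rewrite /virtual (vert_blockE (h := h)) // !inE eqxx.
Qed.

Lemma edge_eq (G : pregraph) (h h' : hedge G) :
  is_graph G -> h' \in edge h -> edge h' = edge h.
Proof.
by move=> gG /set2P[]-> //; rewrite /edge (sigma_involutive gG) setUC.
Qed.

Lemma edge_sym (G : pregraph) (h h' : hedge G) :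
  is_graph G -> (h' \in edge h) = (h \in edge h').
Proof.
by move=> gG; apply/idP/idP => /(edge_eq gG) ->; rewrite !inE eqxx.
Qed.

Lemma real_vertexE (G : pregraph) (h : hedge G) (v : {set hedge G}) :
  is_graph G -> h \in v -> real_vertex v = (v \in verts G) && ~~ virtual h.
Proof.
move=> gG hv; rewrite /real_vertex /virtual_vertex.
case vG: (v \in verts G) => //=; congr (~~ _).
apply/existsP/andP => [[h' /andP[ne /eqP vE]]|[ne eG]].
- have hh' : h \in edge h' by rewrite -vE.
  rewrite (edge_eq gG hh') -vE; split=> //.
  by case/set2P: hh' => -> //; rewrite (sigma_involutive gG) eq_sym.
- exists h; rewrite ne /=.
  have hE : h \in edge h by rewrite !inE eqxx.
  by move: vG eG; rewrite !(vert_blockE (h := h)) // => /eqP<- /eqP<-.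
Qed.

Lemma emb_edge (G1 G2 : pregraph) (phi : hedge G1 -> hedge G2) (h : hedge G1) :
  embedding phi -> edge (phi h) = phi @: edge h.
Proof. by move=> e; rewrite /edge imsetU1 imset_set1 emb_sigma. Qed.

Lemma emb_virtual (G1 G2 : pregraph) (phi : hedge G1 -> hedge G2) (h : hedge G1) :
  is_graph G1 -> is_graph G2 -> embedding phi -> virtual (phi h) = virtual h.
Proof.
move=> g1 g2 e; rewrite !virtualE // -emb_sigma // (inj_eq (emb_inj e)).
by rewrite emb_block // emb_edge // (inj_eq (imset_inj (emb_inj e))).
Qed.

Lemma emb_leg (G1 G2 : pregraph) (phi : hedge G1 -> hedge G2) (h : hedge G1) :
  is_graph G1 -> is_graph G2 -> embedding phi -> leg (phi h) = leg h.
Proof.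
by move=> g1 g2 e; rewrite /leg emb_virtual // -emb_sigma // (inj_eq (emb_inj e)).
Qed.

Lemma emb_real (G1 G2 : pregraph) (phi : hedge G1 -> hedge G2)
    (v : {set hedge G1}) :
  is_graph G1 -> is_graph G2 -> embedding phi -> v != set0 ->
  real_vertex (phi @: v) = real_vertex v.
Proof.
move=> g1 g2 e /set0Pn[h hv].
have hv' : phi h \in phi @: v by rewrite imset_f.
rewrite (real_vertexE g1 hv) (real_vertexE g2 hv') emb_virtual //.
rewrite (vert_blockE g1 hv) (vert_blockE g2 hv') emb_block //.
by rewrite (inj_eq (imset_inj (emb_inj e))).
Qed.

Lemma emb_step (G1 G2 : pregraph) (phi : hedge G1 -> hedge G2) (h h' : hedge G1) :
  embedding phi -> edge_step h h' -> edge_step (phi h) (phi h').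
Proof.
move=> e /existsP[a /andP[ah /existsP[b /andP[bh /and3P[sa sb ab]]]]].
apply/existsP; exists (phi a); rewrite emb_edge // imset_f //=.
apply/existsP; exists (phi b); rewrite emb_edge // imset_f //=.
by rewrite !emb_sgn // sa sb /same_vertex emb_block // imset_f.
Qed.

Lemma emb_step_inv (G1 G2 : pregraph) (phi : hedge G1 -> hedge G2)
    (h : hedge G1) (y : hedge G2) :
  is_graph G2 -> embedding phi -> edge_step (phi h) y ->
  exists2 h', y = phi h' & edge_step h h'.
Proof.
move=> g2 e /existsP[a /andP[ah /existsP[b /andP[bh /and3P[sa sb ab]]]]].
move: ah; rewrite emb_edge // => /imsetP[a' ah' aE].
move: ab; rewrite aE /same_vertex emb_block // => /imsetP[b' ab' bE].
move: bh; rewrite edge_sym // bE emb_edge // => /imsetP[h' hb' yE].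
exists h' => //; apply/existsP; exists a'; rewrite ah' /=.
apply/existsP; exists b'; apply/andP; split.
  have : phi b' \in edge (phi h').
    by rewrite edge_sym // emb_edge // imset_f.
  by rewrite emb_edge // => /imsetP[b'' ? /(emb_inj e) ->].
by move: sa sb; rewrite aE bE !emb_sgn // => -> ->.
Qed.

Lemma emb_leads (G1 G2 : pregraph) (phi : hedge G1 -> hedge G2) (h h' : hedge G1) :
  embedding phi -> leads h h' -> leads (phi h) (phi h').
Proof.
move=> e /orP[hh'|]; first by rewrite /leads emb_edge // imset_f.
case/connectP => p hp ->; apply/orP; right.
elim: p h hp => [|z p IH] h /=; first by rewrite connect0.
by case/andP => /(emb_step e)/connect1 s /IH; apply: connect_trans.
Qed.

Lemma emb_leads_inv (G1 G2 : pregraph) (phi : hedge G1 -> hedge G2)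
    (h : hedge G1) (y : hedge G2) :
  is_graph G2 -> embedding phi -> leads (phi h) y ->
  exists2 h', y = phi h' & leads h h'.
Proof.
move=> g2 e /orP[|].
  by rewrite emb_edge // => /imsetP[h' hh' ->]; exists h'; rewrite // /leads hh'.
case/connectP => p hp ->.
suff [h' -> c] : exists2 h', last (phi h) p = phi h' & connect (@edge_step G1) h h'.
  by exists h' => //; rewrite /leads c orbT.
elim: p h hp => [|z p IH] h /=; first by exists h.
case/andP => /(emb_step_inv g2 e)[h1 -> s] /IH[h' -> c].
by exists h' => //; apply: connect_trans c; apply: connect1.
Qed.

Lemma emb_ordered (G1 G2 : pregraph) (phi : hedge G1 -> hedge G2)
    (A : {set hedge G1}) :
  is_edge_order G1 -> is_edge_order G2 -> embedding phi ->
  {in A &, forall h h', h' \in edge h -> h' = h} ->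
  ordered (phi @: A) = map phi (ordered A).
Proof.
move=> o1 o2 e sA; apply: ordered_eq => //.
- move=> _ _ /imsetP[h hA ->] /imsetP[h' hA' ->].
  rewrite emb_edge // => /imsetP[h'' hE /(emb_inj e) h'E].
  by rewrite h'E in hA' *; rewrite (sA h h'').
- rewrite sorted_map (eq_sorted (e' := @prec G1)); first exact: ordered_sorted.
  by move=> h h' /=; rewrite emb_prec.
- move=> y; apply/mapP/imsetP => -[h hA ->]; exists h => //.
    by rewrite -mem_ordered.
  by rewrite mem_ordered.
Qed.

Lemma emb_vin (G1 G2 : pregraph) (phi : hedge G1 -> hedge G2) (v : {set hedge G1}) :
  embedding phi -> vin (phi @: v) = phi @: vin v.
Proof.
move=> e; apply/setP => y; rewrite inE; apply/andP/imsetP.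
- move=> [/imsetP[h hv ->]]; rewrite emb_sgn // => s.
  by exists h => //; rewrite inE hv s.
- by move=> [h]; rewrite inE => /andP[hv s] ->; rewrite imset_f // emb_sgn.
Qed.

Lemma emb_vout (G1 G2 : pregraph) (phi : hedge G1 -> hedge G2)
    (v : {set hedge G1}) :
  embedding phi -> vout (phi @: v) = phi @: vout v.
Proof.
move=> e; apply/setP => y; rewrite inE; apply/andP/imsetP.
- move=> [/imsetP[h hv ->]]; rewrite emb_sgn // => s.
  by exists h => //; rewrite inE hv s.
- by move=> [h]; rewrite inE => /andP[hv s] ->; rewrite imset_f // emb_sgn.
Qed.

Lemma sum_partition (A B : finType) (P : {set {set A}}) (Q : {set {set B}}) :
  partition P setT -> partition Q setT ->
  partition ([set inl @: v | v : {set A} in P] :|: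
             [set inr @: v | v : {set B} in Q]) [set: A + B].
Proof.
move=> pP pQ; case/and3P: (pP) => _ tP nP; case/and3P: (pQ) => _ tQ nQ.
have dlr (X : {set A}) (Y : {set B}) : [disjoint inl @: X & inr @: Y].
  by apply/pred0P => y /=; apply/andP => -[/imsetP[a _ ->] /imsetP[]].
apply/and3P; split.
- apply/eqP/setP => -[a|b]; rewrite !inE; apply/bigcupP.
  + have aP : a \in cover P by rewrite (cover_partition pP) inE.
    exists (inl @: pblock P a); last by rewrite imset_f // mem_pblock.
    by rewrite inE imset_f // pblock_mem.
  + have bQ : b \in cover Q by rewrite (cover_partition pQ) inE.
    exists (inr @: pblock Q b); last by rewrite imset_f // mem_pblock.
    by rewrite inE orbC imset_f // pblock_mem.
- apply/trivIsetP => X Y.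
  case/setUP => /imsetP[X' vX ->]; case/setUP => /imsetP[Y' vY ->] ne.
  + rewrite (imset_disjoint (@inl_inj _ _)).
    by apply: (trivIsetP tP) => //; apply: contra ne => /eqP->.
  + exact: dlr.
  + by rewrite disjoint_sym; apply: dlr.
  + rewrite (imset_disjoint (@inr_inj _ _)).
    by apply: (trivIsetP tQ) => //; apply: contra ne => /eqP->.
- rewrite inE negb_or; apply/andP; split; apply/negP => /imsetP[v vG] /esym/eqP;
    rewrite imset_eq0 => /eqP v0.
    by rewrite v0 (negPf nP) in vG.
  by rewrite v0 (negPf nQ) in vG.
Qed.

Lemma tensor_is_graph (G1 G2 : pregraph) :
  is_graph G1 -> is_graph G2 -> is_graph (tensor_graph G1 G2).
Proof.
move=> g1 g2; split.
- by apply: sum_partition; apply: verts_partition.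
- by case=> h /=; rewrite sigma_involutive.
- move=> v h; case/setUP => /imsetP[w wG ->] /imsetP[a aw ->] /imsetP[b bw /= [E]] ne;
    rewrite (edge_in_vertex _ wG aw) ?E //; try by rewrite -E; apply: contra ne => /eqP->.
  + by rewrite /edge imsetU1 imset_set1 /= E.
  + by rewrite /edge imsetU1 imset_set1 /= E.
Qed.

Lemma inl_embedding (G1 G2 : pregraph) : is_graph G1 -> is_graph G2 ->
  embedding (inl : hedge G1 -> hedge (tensor_graph G1 G2)).
Proof.
move=> g1 g2; split=> // [|h]; first exact: inl_inj.
apply/eqP; rewrite -(vert_blockE (tensor_is_graph g1 g2)).
  by rewrite inE imset_f // block_vert.
by rewrite imset_f // mem_block.
Qed.

Lemma inr_embedding (G1 G2 : pregraph) : is_graph G1 -> is_graph G2 ->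
  embedding (inr : hedge G2 -> hedge (tensor_graph G1 G2)).
Proof.
move=> g1 g2; split=> // [|h]; first exact: inr_inj.
apply/eqP; rewrite -(vert_blockE (tensor_is_graph g1 g2)).
  by rewrite inE orbC imset_f // block_vert.
by rewrite imset_f // mem_block.
Qed.

Lemma tensor_edge_order (G1 G2 : pregraph) :
  is_edge_order G1 -> is_edge_order G2 -> is_edge_order (tensor_graph G1 G2).
Proof.
move=> [sl1 sr1 i1 t1 l1] [sl2 sr2 i2 t2 l2]; split.
- by case=> h [] h' /=.
- by case=> h [] h' /=.
- by case=> h /=.
- by case=> y [] x [] z //=; [apply: t1 | apply: t2].
- case=> h [] h' //=; rewrite !inE => ne.
    by apply: l1; rewrite !inE.
  by apply: l2; rewrite !inE.
Qed.

Lemma tensor_planar (G1 G2 : pregraph) :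
  planar_graph G1 -> planar_graph G2 -> planar_graph (tensor_graph G1 G2).
Proof.
move=> p1 p2.
have g1 := planar_is_graph p1; have g2 := planar_is_graph p2.
have gT := tensor_is_graph g1 g2.
have el := inl_embedding g1 g2; have er := inr_embedding g1 g2.
split=> //.
- by case=> h /= ne; apply: planar_orientation => //; apply: contra ne => /eqP->.
- move=> v; case/setUP => /imsetP[w wG ->].
  + rewrite (emb_vin _ el) (emb_vout _ el) !imset_eq0.
    exact: (planar_directed p1).
  + rewrite (emb_vin _ er) (emb_vout _ er) !imset_eq0.
    exact: (planar_directed p2).
- by apply: tensor_edge_order; apply: planar_edge_order.
- case=> h1 h2 ne.
  + case/(emb_leads_inv gT el) => h2' h2E l; rewrite h2E in ne *.
    apply: (planar_leads_prec p1) => //.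
    by apply: contra ne => m; rewrite (emb_edge _ el) imset_f.
  + case/(emb_leads_inv gT er) => h2' h2E l; rewrite h2E in ne *.
    apply: (planar_leads_prec p2) => //.
    by apply: contra ne => m; rewrite (emb_edge _ er) imset_f.
- case=> h1 h2 h3.
  + case/(emb_leads_inv gT el) => h2' -> l; case: h3 => h3 //= l1 l2.
    by case/orP: (planar_between p1 l l1 l2) => /(emb_leads el) ->; rewrite ?orbT.
  + case/(emb_leads_inv gT er) => h2' -> l; case: h3 => h3 //= l1 l2.
    by case/orP: (planar_between p2 l l1 l2) => /(emb_leads er) ->; rewrite ?orbT.
Qed.

Lemma tensor_ordered (G1 G2 : pregraph)
    (A1 : {set hedge G1}) (A2 : {set hedge G2})
    (A : {set hedge (tensor_graph G1 G2)}) :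
  is_edge_order G1 -> is_edge_order G2 ->
  {in A1 &, forall h h', h' \in edge h -> h' = h} ->
  {in A2 &, forall h h', h' \in edge h -> h' = h} ->
  A = inl @: A1 :|: inr @: A2 ->
  ordered A = map inl (ordered A1) ++ map inr (ordered A2).
Proof.
move=> o1 o2 s1 s2 AE; have oT := tensor_edge_order o1 o2.
apply: ordered_eq => //.
- rewrite AE => x y.
  case/setUP => /imsetP[a aA ->]; case/setUP => /imsetP[b bA ->] //.
  + move=> m; congr inl; apply: s1 => //; move: m; rewrite !inE.
    by [].
  + by rewrite !inE.
  + by rewrite !inE.
  + move=> m; congr inr; apply: s2 => //; move: m; rewrite !inE.
    by [].
- rewrite (sorted_pairwise (prec_trans oT)) pairwise_cat !pairwise_map.
  apply/and3P; split.
  + by apply/allrelP => x y /mapP[a _ ->] /mapP[b _ ->].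
  + by have := ordered_sorted o1 s1; rewrite (sorted_pairwise (prec_trans o1)).
  + by have := ordered_sorted o2 s2; rewrite (sorted_pairwise (prec_trans o2)).
- move=> y; rewrite AE mem_cat inE; congr (_ || _).
  + apply/mapP/imsetP => -[h hA ->]; exists h => //.
      by rewrite -mem_ordered.
    by rewrite mem_ordered.
  + apply/mapP/imsetP => -[h hA ->]; exists h => //.
      by rewrite -mem_ordered.
    by rewrite mem_ordered.
Qed.

Lemma tensor_gin (G1 G2 : pregraph) : is_graph G1 -> is_graph G2 ->
  gin (tensor_graph G1 G2) = inl @: gin G1 :|: inr @: gin G2.
Proof.
move=> g1 g2; have gT := tensor_is_graph g1 g2.
have el := inl_embedding g1 g2; have er := inr_embedding g1 g2.
apply/setP => -[h|h]; rewrite !inE.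
- rewrite (emb_leg h g1 gT el) (emb_sgn el) (mem_imset _ _ (@inl_inj _ _)) inE.
  rewrite orbC; case: imsetP => //; by case.
- rewrite (emb_leg h g2 gT er) (emb_sgn er) (mem_imset _ _ (@inr_inj _ _)) inE.
  case: imsetP => //; by case.
Qed.

Lemma tensor_gout (G1 G2 : pregraph) : is_graph G1 -> is_graph G2 ->
  gout (tensor_graph G1 G2) = inl @: gout G1 :|: inr @: gout G2.
Proof.
move=> g1 g2; have gT := tensor_is_graph g1 g2.
have el := inl_embedding g1 g2; have er := inr_embedding g1 g2.
apply/setP => -[h|h]; rewrite !inE.
- rewrite (emb_leg h g1 gT el) (emb_sgn el) (mem_imset _ _ (@inl_inj _ _)) inE.
  rewrite orbC; case: imsetP => //; by case.
- rewrite (emb_leg h g2 gT er) (emb_sgn er) (mem_imset _ _ (@inr_inj _ _)) inE.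
  case: imsetP => //; by case.
Qed.

Lemma tensor_gdom (D : tensor_scheme) (G1 G2 : prediagram D) :
  planar_graph G1 -> planar_graph G2 ->
  gdom (tensor G1 G2) = gdom G1 ++ gdom G2.
Proof.
move=> p1 p2; have o1 := planar_edge_order p1; have o2 := planar_edge_order p2.
rewrite /gdom /word_along (tensor_ordered (A1 := gin G1) (A2 := gin G2)) //.
- by rewrite map_cat -!map_comp.
- exact: gin_separated (planar_orientation p1).
- exact: gin_separated (planar_orientation p2).
- exact: tensor_gin (planar_is_graph p1) (planar_is_graph p2).
Qed.

Lemma tensor_gcod (D : tensor_scheme) (G1 G2 : prediagram D) :
  planar_graph G1 -> planar_graph G2 ->
  gcod (tensor G1 G2) = gcod G1 ++ gcod G2.
Proof.
move=> p1 p2; have o1 := planar_edge_order p1; have o2 := planar_edge_order p2.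
rewrite /gcod /word_along (tensor_ordered (A1 := gout G1) (A2 := gout G2)) //.
- by rewrite map_cat -!map_comp.
- exact: gout_separated (planar_orientation p1).
- exact: gout_separated (planar_orientation p2).
- exact: tensor_gout (planar_is_graph p1) (planar_is_graph p2).
Qed.

Lemma sum_dec_m_inl (D : tensor_scheme) (G1 G2 : prediagram D)
    (v : {set hedge G1}) : @sum_dec_m D G1 G2 (inl @: v) = dec_m v.
Proof.
rewrite /sum_dec_m.
have -> : [set b | inr b \in inl @: v] = set0 :> {set hedge G2}.
  by apply/setP => b; rewrite !inE; apply/imsetP => -[].
rewrite eqxx; congr dec_m; apply/setP => a.
by rewrite inE (mem_imset _ _ (@inl_inj _ _)).
Qed.

Lemma sum_dec_m_inr (D : tensor_scheme) (G1 G2 : prediagram D)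
    (v : {set hedge G2}) : v != set0 ->
  @sum_dec_m D G1 G2 (inr @: v) = dec_m v.
Proof.
move=> v0; rewrite /sum_dec_m.
have -> : [set a | inl a \in inr @: v] = set0 :> {set hedge G1}.
  by apply/setP => b; rewrite !inE; apply/imsetP => -[].
set v2 := [set b | inr b \in _]; have -> : v2 = v.
  by apply/setP => b; rewrite inE (mem_imset _ _ (@inr_inj _ _)).
by rewrite (negPf v0) eqxx.
Qed.

Lemma set0_not_real (D : tensor_scheme) (G : prediagram D) :
  is_diagram G -> dec_m (set0 : {set hedge G}) = None.
Proof.
move=> dG; have := diagram_real dG set0.
case/and3P: (verts_partition (planar_is_graph (diagram_planar dG))) => _ _.
by rewrite /real_vertex => /negPf-> /=; case: (dec_m _).
Qed.

Lemma tensor_diagram (D : tensor_scheme) (G1 G2 : prediagram D) :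
  is_diagram G1 -> is_diagram G2 -> is_diagram (tensor G1 G2).
Proof.
move=> d1 d2; have p1 := diagram_planar d1; have p2 := diagram_planar d2.
have g1 := planar_is_graph p1; have g2 := planar_is_graph p2.
have pT := tensor_planar p1 p2; have gT := planar_is_graph pT.
have el := inl_embedding g1 g2; have er := inr_embedding g1 g2.
have o1 := planar_edge_order p1; have o2 := planar_edge_order p2.
have oT := planar_edge_order pT.
have realE v : isSome (dec_m v) = @real_vertex (tensor G1 G2) v.
  apply/idP/idP.
  + rewrite /= /sum_dec_m; set v1 := [set a | inl a \in _]; set v2 := [set b | inr b \in _].
    case: ifP => [/eqP v20|v2n].
    * rewrite diagram_real // => r.
      have v1n : v1 != set0.
        apply/eqP => v10; move: r.
        by rewrite -/v1 v10 -(diagram_real d1) set0_not_real.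
      have -> : v = inl @: v1.
        apply/setP => -[a|b].
          by rewrite (mem_imset _ _ (@inl_inj _ _)) inE.
        have -> : (inr b \in v) = (b \in v2) by rewrite inE.
        by rewrite v20 inE; apply/esym/imsetP => -[].
      by rewrite (emb_real g1 gT el v1n).
    * case: ifP => // /eqP v10; rewrite diagram_real // => r.
      have -> : v = inr @: v2.
        apply/setP => -[a|b]; last first.
          by rewrite (mem_imset _ _ (@inr_inj _ _)) inE.
        have -> : (inl a \in v) = (a \in v1) by rewrite inE.
        by rewrite v10 inE; apply/esym/imsetP => -[].
      by rewrite (emb_real g2 gT er) ?v2n.
  + move=> r; case/andP: (r) => /setUP[] /imsetP[w wG vE] _; rewrite vE in r *.
    * have wn : w != set0.
        apply: contraTneq wG => ->.
        by case/and3P: (verts_partition g1).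
      rewrite /= sum_dec_m_inl diagram_real //.
      by move: r; rewrite (emb_real g1 gT el wn).
    * have wn : w != set0.
        apply: contraTneq wG => ->.
        by case/and3P: (verts_partition g2).
      rewrite /= sum_dec_m_inr // diagram_real //.
      by move: r; rewrite (emb_real g2 gT er wn).
split=> //; first by case=> h /=; rewrite diagram_sigma.
move=> v f vf.
have : @real_vertex (tensor G1 G2) v by rewrite -realE vf.
case/andP => /setUP[] /imsetP[w wG vE] _; move: vf; rewrite vE.
- rewrite /= sum_dec_m_inl => /(diagram_word d1) [-> ->]; split.
  + rewrite /word_along (emb_vin _ el) (emb_ordered o1 oT el).
      by rewrite -map_comp.
    exact: vin_separated (planar_orientation p1).
  + rewrite /word_along (emb_vout _ el) (emb_ordered o1 oT el).
      by rewrite -map_comp.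
    exact: vout_separated (planar_orientation p1).
- have wn : w != set0.
    apply: contraTneq wG => ->.
    by case/and3P: (verts_partition g2).
  rewrite /= sum_dec_m_inr // => /(diagram_word d2) [-> ->]; split.
  + rewrite /word_along (emb_vin _ er) (emb_ordered o2 oT er).
      by rewrite -map_comp.
    exact: vin_separated (planar_orientation p2).
  + rewrite /word_along (emb_vout _ er) (emb_ordered o2 oT er).
      by rewrite -map_comp.
    exact: vout_separated (planar_orientation p2).
Qed.

(* [bd_class] is the isomorphism class of the underlying diagram, as a set of
   diagrams. *)
Record bracketed_diagram (D : tensor_scheme) := BracketedDiagram {
  bd_dom : seq (seq (Ob D));
  bd_cod : seq (seq (Ob D));
  bd_class : prediagram D -> Prop;
  bd_dom_nonempty : 0 < size bd_dom;
  bd_cod_nonempty : 0 < size bd_cod;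
  bd_spec : exists G : prediagram D,
    [/\ is_diagram G, gdom G = flatten bd_dom, gcod G = flatten bd_cod &
        forall G', bd_class G' <-> diagram_iso G G']
}.

Definition T (D : tensor_scheme) : tensor_scheme :=
  @TensorScheme (seq (Ob D)) (bracketed_diagram D)
    (@bd_dom D) (@bd_cod D) (@bd_dom_nonempty D) (@bd_cod_nonempty D).

Definition bracket (D : tensor_scheme) (w u : seq (seq (Ob D)))
    (G : prediagram D) (w_nonempty : 0 < size w) (u_nonempty : 0 < size u)
    (G_ok : is_diagram G) (G_dom : gdom G = flatten w)
    (G_cod : gcod G = flatten u) : Mor (T D) :=
  @BracketedDiagram D w u (diagram_iso G) w_nonempty u_nonempty
    (ex_intro _ G (And4 G_ok G_dom G_cod (fun G' => iff_refl _))).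

Lemma relabel_spec (D D' : tensor_scheme) (phi : scheme_hom D D')
    (X : bracketed_diagram D) :
  exists G : prediagram D',
    [/\ is_diagram G, gdom G = flatten (map (map (hom_o phi)) (bd_dom X)),
        gcod G = flatten (map (map (hom_o phi)) (bd_cod X)) &
        forall G', (exists2 G0, bd_class X G0 & diagram_iso (relabel phi G0) G')
                   <-> diagram_iso G G'].
Proof.
case: (bd_spec X) => G [G_ok Gd Gc GP]; exists (relabel phi G); split.
- exact: relabel_diagram.
- by rewrite -map_flatten -Gd; apply: relabel_word.
- by rewrite -map_flatten -Gc; apply: relabel_word.
- move=> G'; split=> [[G0 /GP i0]|i].
    by apply: diagram_iso_trans; apply: relabel_iso.
  by exists G => //; apply/GP; apply: diagram_iso_refl.
Qed.

Definition T_hom_m (D D' : tensor_scheme) (phi : scheme_hom D D')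
    (X : Mor (T D)) : Mor (T D') :=
  @BracketedDiagram D'
    (map (map (hom_o phi)) (bd_dom X)) (map (map (hom_o phi)) (bd_cod X))
    (fun G' => exists2 G, bd_class X G & diagram_iso (relabel phi G) G')
    (eq_ind_r (fun n => 0 < n) (bd_dom_nonempty X) (size_map _ _))
    (eq_ind_r (fun n => 0 < n) (bd_cod_nonempty X) (size_map _ _))
    (relabel_spec phi X).

Definition T_hom (D D' : tensor_scheme) (phi : scheme_hom D D') :
    scheme_hom (T D) (T D') :=
  @SchemeHom (T D) (T D') (map (hom_o phi)) (T_hom_m phi)
    (fun _ => erefl) (fun _ => erefl).

Definition letters (A : Type) (w : seq A) : seq (seq A) := [seq [:: x] | x <- w].

Lemma size_letters (A : Type) (w : seq A) : size (letters w) = size w.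
Proof. exact: size_map. Qed.

Lemma flatten_letters (A : Type) (w : seq A) : flatten (letters w) = w.
Proof. exact: flatten_seq1. Qed.

Definition eta_m (D : tensor_scheme) (f : Mor D) : Mor (T D) :=
  @bracket D (letters (dom f)) (letters (cod f)) (prime_diagram f)
    (eq_ind_r (fun n => 0 < n) (dom_nonempty f) (size_letters _))
    (eq_ind_r (fun n => 0 < n) (cod_nonempty f) (size_letters _))
    (prime_diagram_ok f)
    (etrans (prime_gdom f) (esym (flatten_letters _)))
    (etrans (prime_gcod f) (esym (flatten_letters _))).

Definition eta (D : tensor_scheme) : scheme_hom D (T D) :=
  @SchemeHom D (T D) (fun x => [:: x]) (@eta_m D)
    (fun _ => erefl) (fun _ => erefl).

(* [value X G]: the diagram [X] in [T D] is obtained by tensoring and composing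
   prime and unitary diagrams, and [G] is obtained in the same way from the
   diagrams in [D] that decorate the vertices and the identities of the words
   that decorate the edges. *)
Inductive value (D : tensor_scheme) : prediagram (T D) -> prediagram D -> Prop :=
| value_iso X X' G G' :
    diagram_iso X X' -> diagram_iso G G' -> value X G -> value X' G'
| value_empty : value (empty_diagram (T D)) (empty_diagram D)
| value_unitary (w : Ob (T D)) :
    value (unitary_diagram w) (identity_diagram w)
| value_prime (f : Mor (T D)) G :
    bd_class f G -> value (prime_diagram f) G
| value_tensor X1 X2 G1 G2 :
    value X1 G1 -> value X2 G2 -> value (tensor X1 X2) (tensor G1 G2)
| value_comp X1 X2 G1 G2 :
    gcod X1 = gdom X2 ->
    value X1 G1 -> value X2 G2 -> value (compose X2 X1) (compose G2 G1).

Definition mu_o (D : tensor_scheme) : Ob (T (T D)) -> Ob (T D) := flatten.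

(* The graph of the action of mu on morphisms: [mu_m X Y] reads "mu X = Y".
   The value of a diagram is unique up to isomorphism, since diagrams in [D]
   form a strict monoidal category. *)
Definition mu_m (D : tensor_scheme) (X : Mor (T (T D))) (Y : Mor (T D)) : Prop :=
  [/\ dom Y = map (@mu_o D) (dom X), cod Y = map (@mu_o D) (cod X) &
      exists V G, [/\ bd_class X V, bd_class Y G & value V G]].

Record tensor_manifold := TensorManifold {
  scheme_of :> tensor_scheme;
  eps : scheme_hom (T scheme_of) scheme_of;
  eps_assoc_o : forall w : Ob (T (T scheme_of)),
    hom_o eps (hom_o (T_hom eps) w) = hom_o eps (mu_o w);
  eps_assoc_m : forall (X : Mor (T (T scheme_of))) (Y : Mor (T scheme_of)),
    mu_m X Y -> hom_m eps (hom_m (T_hom eps) X) = hom_m eps Y;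
  eps_unit_o : forall x : Ob scheme_of, hom_o eps (hom_o (eta scheme_of) x) = x;
  eps_unit_m : forall f : Mor scheme_of, hom_m eps (hom_m (eta scheme_of) f) = f
}.

Lemma tensor_letters_size (A : Type) (w w' : seq A) :
  0 < size w -> 0 < size (letters w ++ letters w').
Proof. by rewrite size_cat !size_letters => w0; rewrite ltn_addr. Qed.

Lemma tensor_prime_gdom (D : tensor_scheme) (f g : Mor D) :
  gdom (tensor (prime_diagram f) (prime_diagram g)) =
  flatten (letters (dom f) ++ letters (dom g)).
Proof.
rewrite flatten_cat !flatten_letters tensor_gdom ?prime_gdom //;
  exact: diagram_planar (prime_diagram_ok _).
Qed.

Lemma tensor_prime_gcod (D : tensor_scheme) (f g : Mor D) :
  gcod (tensor (prime_diagram f) (prime_diagram g)) =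
  flatten (letters (cod f) ++ letters (cod g)).
Proof.
rewrite flatten_cat !flatten_letters tensor_gcod ?prime_gcod //;
  exact: diagram_planar (prime_diagram_ok _).
Qed.

Definition tensor_letters (D : tensor_scheme) (f g : Mor D) : Mor (T D) :=
  @bracket D (letters (dom f) ++ letters (dom g))
    (letters (cod f) ++ letters (cod g))
    (tensor (prime_diagram f) (prime_diagram g))
    (tensor_letters_size _ (dom_nonempty f))
    (tensor_letters_size _ (cod_nonempty f))
    (tensor_diagram (prime_diagram_ok f) (prime_diagram_ok g))
    (tensor_prime_gdom f g) (tensor_prime_gcod f g).

Definition tensor_eps (M : tensor_manifold) (f g : Mor M) : Mor M :=
  hom_m (eps M) (tensor_letters f g).

Lemma eps_letters (M : tensor_manifold) (w : seq (Ob M)) :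
  map (hom_o (eps M)) (letters w) = w.
Proof. by elim: w => //= x w ->; rewrite (eps_unit_o x). Qed.

Lemma tensor_eps_dom (M : tensor_manifold) (f g : Mor M) :
  dom (tensor_eps f g) = dom f ++ dom g.
Proof. by rewrite hom_dom /= map_cat !eps_letters. Qed.

Lemma tensor_eps_cod (M : tensor_manifold) (f g : Mor M) :
  cod (tensor_eps f g) = cod f ++ cod g.
Proof. by rewrite hom_cod /= map_cat !eps_letters. Qed.

Record linear_partition := LinearPartition {
  lp_set : finType;
  lp_le : rel lp_set;
  lp_blocks : {set {set lp_set}};
  lp_anti : antisymmetric lp_le;
  lp_trans : transitive lp_le;
  lp_total : total lp_le;
  lp_partition : partition lp_blocks [set: lp_set];
  lp_convex : forall (b : {set lp_set}) x y z, b \in lp_blocks ->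
    x \in b -> z \in b -> lp_le x y -> lp_le y z -> y \in b
}.

Definition lp_norm (I : linear_partition) : nat := #|lp_set I|.

Definition lp_elements (I : linear_partition) : seq (lp_set I) :=
  sort (@lp_le I) (enum (lp_set I)).

Definition lp_block_le (I : linear_partition) (b b' : {set lp_set I}) : bool :=
  (b == b') || [forall x in b, forall y in b', lp_le x y].

Definition lp_block_seq (I : linear_partition) : seq {set lp_set I} :=
  sort (@lp_block_le I) (enum (lp_blocks I)).

(* the word [w], of length [lp_norm I], cut into consecutive words along [I] *)
Definition lp_cut (I : linear_partition) (A : Type) (w : seq A) : seq (seq A) :=
  [seq mask [seq x \in b | x <- lp_elements I] w
    | b : {set lp_set I} <- lp_block_seq I].

Definition lp_tensor_le (I J : linear_partition) (x y : lp_set I + lp_set J) :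
    bool :=
  match x, y with
  | inl a, inl a' => lp_le a a'
  | inl _, inr _ => true
  | inr _, inl _ => false
  | inr b, inr b' => lp_le b b'
  end.

Definition lp_tensor_blocks (I J : linear_partition) :
    {set {set lp_set I + lp_set J}} :=
  [set inl @: b | b : {set lp_set I} in lp_blocks I] :|:
  [set inr @: b | b : {set lp_set J} in lp_blocks J].

Lemma lp_tensor_anti (I J : linear_partition) :
  antisymmetric (@lp_tensor_le I J).
Proof. by case=> x [] y //= /lp_anti ->. Qed.

Lemma lp_tensor_trans (I J : linear_partition) :
  transitive (@lp_tensor_le I J).
Proof. by case=> y [] x [] z //=; apply: lp_trans. Qed.

Lemma lp_tensor_total (I J : linear_partition) : total (@lp_tensor_le I J).
Proof. by case=> x [] y //=; apply: lp_total. Qed.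

Lemma lp_tensor_partition (I J : linear_partition) :
  partition (lp_tensor_blocks I J) [set: lp_set I + lp_set J].
Proof. by apply: sum_partition; apply: lp_partition. Qed.

Lemma lp_tensor_convex (I J : linear_partition)
    (b : {set lp_set I + lp_set J}) x y z :
  b \in lp_tensor_blocks I J -> x \in b -> z \in b ->
  lp_tensor_le x y -> lp_tensor_le y z -> y \in b.
Proof.
case/setUP => /imsetP[c cP ->] /imsetP[x' xc ->] /imsetP[z' zc ->];
  case: y => y //= xy yz; rewrite imset_f //; exact: lp_convex xy yz.
Qed.

Definition lp_tensor (I J : linear_partition) : linear_partition :=
  @LinearPartition (lp_set I + lp_set J)%type (@lp_tensor_le I J)
    (lp_tensor_blocks I J) (@lp_tensor_anti I J) (@lp_tensor_trans I J)
    (@lp_tensor_total I J) (lp_tensor_partition I J) (@lp_tensor_convex I J).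

Lemma lp_tensor_norm (I J : linear_partition) :
  lp_norm (lp_tensor I J) = lp_norm I + lp_norm J.
Proof. exact: card_sum. Qed.

Lemma lp_block_seqP (I : linear_partition) :
  pairwise (fun b b' : {set lp_set I} =>
    [forall x in b, forall y in b', lp_le x y && (x != y)]) (lp_block_seq I).
Proof.
case/and3P: (lp_partition I) => _ tI nI.
have nonempty b : b \in lp_blocks I -> exists x, x \in b.
  by move=> bI; apply/set0Pn; apply: contraNneq nI => <-.
have apart b b' x y : b \in lp_blocks I -> b' \in lp_blocks I -> b != b' ->
    x \in b -> y \in b' -> x != y.
  move=> bI b'I ne xb yb'; apply/eqP => xy.
  have /pred0P/(_ x) /= := trivIsetP tI _ _ bI b'I ne.
  by rewrite xb xy yb'.
have sep b b' a c : b \in lp_blocks I -> b' \in lp_blocks I -> b != b' ->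
    a \in b -> c \in b' -> lp_le a c ->
    [forall x in b, forall y in b', lp_le x y].
  move=> bI b'I ne ab cb' ac; apply/forall_inP => x xb; apply/forall_inP => y yb'.
  case/orP: (lp_total x y) => // yx; exfalso.
  case/orP: (lp_total x c) => xc.
    have := apart _ _ _ _ bI b'I ne xb (lp_convex b'I yb' cb' yx xc).
    by rewrite eqxx.
  have := apart _ _ _ _ bI b'I ne (lp_convex bI ab xb ac xc) cb'.
  by rewrite eqxx.
have tot : {in lp_blocks I &, total (@lp_block_le I)}.
  move=> b b' bI b'I; rewrite /lp_block_le [b' == b]eq_sym.
  have [//|ne] := eqVneq b b'; rewrite /=.
  have [[x xb] [y yb']] := (nonempty _ bI, nonempty _ b'I).
  case/orP: (lp_total x y) => le; first by rewrite (sep _ _ _ _ bI b'I ne xb yb').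
  by rewrite orbC (sep _ _ _ _ b'I bI _ yb' xb) // eq_sym.
have tra : {in lp_blocks I & &, transitive (@lp_block_le I)}.
  move=> b' b b'' b'I bI b''I; rewrite /lp_block_le.
  have [->|_] //= := eqVneq b b'; have [->|_] := eqVneq b' b''.
    by move=> -> _; rewrite orbT.
  move=> /forall_inP l1 /= /forall_inP l2; apply/orP; right.
  have [y yb'] := nonempty _ b'I.
  apply/forall_inP => x xb; apply/forall_inP => z zb''.
  by apply: lp_trans (forall_inP (l1 x xb) y yb') (forall_inP (l2 y yb') z zb'').
have allI : all (mem (lp_blocks I)) (lp_block_seq I).
  by apply/allP => b; rewrite mem_sort mem_enum.
have s1 : pairwise (@lp_block_le I) (lp_block_seq I).
  rewrite -(sorted_pairwise_in tra allI) /lp_block_seq; apply: (sort_sorted_in tot).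
  by apply/allP => b; rewrite mem_enum.
have s2 : pairwise (fun x y => x != y) (lp_block_seq I).
  by rewrite -uniq_pairwise sort_uniq enum_uniq.
have : pairwise [rel x y | lp_block_le x y && (x != y)] (lp_block_seq I).
  by rewrite pairwise_relI s1 s2.
apply: (@sub_in_pairwise _ (mem (lp_blocks I))) => // b b' bI b'I /= /andP[].
rewrite /lp_block_le => /orP[/eqP->|]; first by rewrite eqxx.
move=> /forall_inP le ne; apply/forall_inP => x xb; apply/forall_inP => y yb'.
by rewrite (forall_inP (le x xb)) //= (apart _ _ _ _ bI b'I ne).
Qed.

Lemma flatten_lp_cut (I : linear_partition) (A : Type) (w : seq A) :
  size w = lp_norm I -> flatten (lp_cut I w) = w.
Proof.
move=> sw; set els := lp_elements I.
have uels : uniq els by rewrite sort_uniq enum_uniq.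
have mels x : x \in els by rewrite mem_sort mem_enum.
have sels : size els = size w by rewrite size_sort -cardE.
pose lt := [rel x y : lp_set I | lp_le x y && (x != y)].
have lt_irr : irreflexive lt by move=> x /=; rewrite eqxx andbF.
have lt_trans : transitive lt.
  move=> y x z /= /andP[xy nxy] /andP[yz nyz]; rewrite (lp_trans xy yz) /=.
  apply: contra nxy => /eqP xz; rewrite -xz in yz.
  by apply/eqP/lp_anti; rewrite xy yz.
have lt_els : pairwise lt els.
  rewrite pairwise_relI -uniq_pairwise uels andbT.
  by rewrite -(sorted_pairwise (@lp_trans I)); apply: sort_sorted; apply: lp_total.
have fE : flatten [seq [seq x <- els | x \in b] | b : {set lp_set I} <- lp_block_seq I] = els.
  apply: (irr_sorted_eq lt_trans lt_irr); rewrite ?(sorted_pairwise lt_trans) //.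
    elim: (lp_block_seq I) (lp_block_seqP I) => //= b s IH /andP[/allP hb /IH].
    rewrite pairwise_cat => ->; rewrite andbT; apply/andP; split.
      apply/allrelP => x y; rewrite mem_filter => /andP[xb _].
      case/flattenP => c /mapP[b' b's ->]; rewrite mem_filter => /andP[yb' _].
      exact: forall_inP (forall_inP (hb _ b's) x xb) y yb'.
    exact: pairwise_filter.
  move=> x; rewrite mels; apply/flattenP.
  have xc : x \in cover (lp_blocks I).
    by rewrite (cover_partition (lp_partition I)) inE.
  exists [seq y <- els | y \in pblock (lp_blocks I) x].
    apply/mapP; exists (pblock (lp_blocks I) x) => //.
    by rewrite mem_sort mem_enum pblock_mem.
  by rewrite mem_filter mem_pblock xc mels.
case: w sw sels => [|x0 w'] sw sels.
  rewrite /lp_cut; elim: (lp_block_seq I) => //= b s ->.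
  by rewrite mask0.
set w := x0 :: w' in sw sels *.
pose g x := nth x0 w (index x els).
have wE : w = map g els.
  apply: (@eq_from_nth _ x0); first by rewrite size_map.
  move=> i iw; have i_els : i < size els by rewrite sels.
  have [z0 _] : exists z0 : lp_set I, true.
    by case: (els) i_els => // z0; exists z0.
  by rewrite (nth_map z0) // /g index_uniq.
transitivity (map g els); last by rewrite -wE.
rewrite /lp_cut -/els -[in RHS]fE map_flatten -map_comp.
congr flatten; apply: eq_map => b.
by rewrite /= filter_mask map_mask -wE.
Qed.

Lemma lp_cut_nonempty (I : linear_partition) (A : Type) (w : seq A) :
  0 < size w -> size w = lp_norm I -> 0 < size (lp_cut I w).
Proof.
move=> w0 /flatten_lp_cut wE; rewrite lt0n; apply: contraTneq w0 => /size0nil c0.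
by rewrite -wE c0.
Qed.

Definition cut_prime (D : tensor_scheme) (I O : linear_partition) (f : Mor D)
    (hI : size (dom f) = lp_norm I) (hO : size (cod f) = lp_norm O) :
    Mor (T D) :=
  @bracket D (lp_cut I (dom f)) (lp_cut O (cod f)) (prime_diagram f)
    (lp_cut_nonempty (dom_nonempty f) hI) (lp_cut_nonempty (cod_nonempty f) hO)
    (prime_diagram_ok f)
    (etrans (prime_gdom f) (esym (flatten_lp_cut hI)))
    (etrans (prime_gcod f) (esym (flatten_lp_cut hO))).

Definition fusion (M : tensor_manifold) (I O : linear_partition) (f : Mor M)
    (hI : size (dom f) = lp_norm I) (hO : size (cod f) = lp_norm O) : Mor M :=
  hom_m (eps M) (cut_prime hI hO).

Lemma tensor_eps_dom_norm (M : tensor_manifold) (f g : Mor M)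
    (I J : linear_partition) :
  size (dom f) = lp_norm I -> size (dom g) = lp_norm J ->
  size (dom (tensor_eps f g)) = lp_norm (lp_tensor I J).
Proof. by move=> hI hJ; rewrite tensor_eps_dom size_cat hI hJ lp_tensor_norm. Qed.

Lemma tensor_eps_cod_norm (M : tensor_manifold) (f g : Mor M)
    (I J : linear_partition) :
  size (cod f) = lp_norm I -> size (cod g) = lp_norm J ->
  size (cod (tensor_eps f g)) = lp_norm (lp_tensor I J).
Proof. by move=> hI hJ; rewrite tensor_eps_cod size_cat hI hJ lp_tensor_norm. Qed.

(* Main.v *)
Require Import Defs.
From mathcomp Require Import all_boot.
From mathcomp Require boolp.
Set Implicit Arguments. Unset Strict Implicit. Unset Printing Implicit Defensive.

(** Both sides are [eps] applied to the diagram [Gamma_f (x) Gamma_g] bracketed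
    along [I1 (x) I2] and [O1 (x) O2]. Indeed, each side is [eps (T eps X)] for a
    bracketed diagram [X] in [T D]: on the left, [X] is the prime diagram with
    vertex [Gamma_f (x) Gamma_g] (in one-letter brackets), cut along the two
    partitions; on the right, [X] is the tensor product of two prime diagrams,
    with vertices [Gamma_f] and [Gamma_g] already cut along the partitions. In
    both cases [mu X] is the diagram above, and [eps (T eps X) = eps (mu X)]. *)

(** By [bd_spec] a class consists of all diagrams isomorphic to a given one, so two classes with a
    common member [G] coincide. The algebra axioms are Leibniz equalities, hence extensionality is
    used to obtain [K = K']. *)
Lemma bracketed_diagram_eq (D : tensor_scheme) (X Y : bracketed_diagram D)
    (G : prediagram D) :
  bd_dom X = bd_dom Y -> bd_cod X = bd_cod Y ->
  bd_class X G -> bd_class Y G -> X = Y.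
Proof.
case: X Y => [d c K dn cn s] [d' c' K' dn' cn' s'] /= ed ec KG K'G.
have eK : K = K'.
  apply: boolp.funext => G'; apply: boolp.propext.
  case: s s' => [H [_ _ _ HP]] [H' [_ _ _ HP']].
  move/HP: KG => i; move/HP': K'G => i'.
  split=> [/HP j|/HP' j]; [apply/HP'|apply/HP].
    exact: diagram_iso_trans i' (diagram_iso_trans (diagram_iso_sym i) j).
  exact: diagram_iso_trans i (diagram_iso_trans (diagram_iso_sym i') j).
(* The proof fields depend on the brackets and the class, so these are substituted before proof
   irrelevance applies. *)
case: _ / ed dn' s' => dn' s'; case: _ / ec cn' s' => cn' s'.
case: _ / eK s' => s'.
by congr BracketedDiagram; apply: boolp.Prop_irrelevance.
Qed.

(** * Isomorphisms of tensored and relabelled diagrams *)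

Lemma tensor_iso (D : tensor_scheme) (G1 G1' G2 G2' : prediagram D) :
  diagram_iso G1 G1' -> diagram_iso G2 G2' ->
  diagram_iso (tensor G1 G2) (tensor G1' G2').
Proof.
move=> [p [[p' pK p'K] vp [sp gp] pp [op mp]]].
move=> [q [[q' qK q'K] vq [sq gq] pq [oq mq]]].
pose r (h : hedge G1 + hedge G2) : hedge G1' + hedge G2' :=
  match h with inl a => inl (p a) | inr b => inr (q b) end.
pose r' (h : hedge G1' + hedge G2') : hedge G1 + hedge G2 :=
  match h with inl a => inl (p' a) | inr b => inr (q' b) end.
have rK : cancel r r' by case=> h /=; rewrite ?pK ?qK.
have r'K : cancel r' r by case=> h /=; rewrite ?p'K ?q'K.
exists r; split=> /=.
- by exists r'.
- rewrite imsetU vp vq -!imset_comp; congr (_ :|: _); apply: eq_imset => v /=;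
    by rewrite -!imset_comp; apply: eq_imset.
- by split; case=> h //=; rewrite ?sp ?sq.
- by case=> h [] h' /=; rewrite ?pp ?pq.
- split=> [[h|h] //=|v]; rewrite /sum_dec_m.
  (* [sum_dec_m] sees a set only through its traces on the two summands, and [r] transports these by
     [p] and [q]. *)
  have -> : [set a | inl a \in r @: v] = p @: [set a | inl a \in v].
    apply/setP => a; rewrite -[a]p'K inE (mem_imset _ _ (can_inj pK)) inE.
    by rewrite -[inl (p _)]/(r (inl (p' a))) (mem_imset _ _ (can_inj rK)).
  have -> : [set b | inr b \in r @: v] = q @: [set b | inr b \in v].
    apply/setP => b; rewrite -[b]q'K inE (mem_imset _ _ (can_inj qK)) inE.
    by rewrite -[inr (q _)]/(r (inr (q' b))) (mem_imset _ _ (can_inj rK)).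
  by rewrite !imset_eq0 mp mq.
Qed.

(** The identity on half-edges works; what remains is to move [omap] inside the tests of
    [sum_dec_m]. *)
Lemma relabel_tensor_iso (D D' : tensor_scheme) (phi : scheme_hom D D')
    (G1 G2 : prediagram D) :
  diagram_iso (relabel phi (tensor G1 G2))
    (tensor (relabel phi G1) (relabel phi G2)).
Proof.
exists id; split=> //=; first by exists id.
- by rewrite -[LHS]imset_id; apply: eq_imset => v; rewrite imset_id.
- split=> [[h|h] //|v]; rewrite imset_id /sum_dec_m /=.
  by case: ifP => // _; case: ifP.
Qed.

(** The two vertices have equally many inputs and outputs, but their ordinal types are only provably
    equal, so half-edges are matched by [cast_ord]. *)
Lemma relabel_prime_iso (D D' : tensor_scheme) (phi : scheme_hom D D')
    (f : Mor D) :
  diagram_iso (relabel phi (prime_diagram f)) (prime_diagram (hom_m phi f)).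
Proof.
have ed : size (dom f) = size (dom (hom_m phi f)) by rewrite hom_dom size_map.
have ec : size (cod f) = size (cod (hom_m phi f)) by rewrite hom_cod size_map.
pose r (h : 'I_(size (dom f)) + 'I_(size (cod f))) :
    'I_(size (dom (hom_m phi f))) + 'I_(size (cod (hom_m phi f))) :=
  match h with inl i => inl (cast_ord ed i) | inr j => inr (cast_ord ec j) end.
pose r' (h : 'I_(size (dom (hom_m phi f))) + 'I_(size (cod (hom_m phi f)))) :
    'I_(size (dom f)) + 'I_(size (cod f)) :=
  match h with
  | inl i => inl (cast_ord (esym ed) i) | inr j => inr (cast_ord (esym ec) j)
  end.
have rK : cancel r r' by case=> h /=; rewrite cast_ordK.
have r'K : cancel r' r by case=> h /=; rewrite cast_ordKV.
have rT : r @: setT = setT.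
  by apply/setP => h; rewrite -[h]r'K (mem_imset _ _ (can_inj rK)) !inE.
exists r; split=> /=.
- by exists r'.
- by rewrite imset_set1 rT.
- by split; case.
- by case=> h [] h'.
- split=> [[i|j]|v].
  (* The index [i] shows that [dom f] has a letter, which supplies the default for [nth]. *)
  + have x0 : Ob D by case: (dom f) i => [[]|].
    by rewrite /= !(tnth_nth (hom_o phi x0)) /= hom_dom (nth_map x0) ?(tnth_nth x0).
  + have x0 : Ob D by case: (cod f) j => [[]|].
    by rewrite /= !(tnth_nth (hom_o phi x0)) /= hom_cod (nth_map x0) ?(tnth_nth x0).
  (* Only the full set is decorated, and [v] is full exactly when [r @: v] is. *)
  + by rewrite -{1}rT (inj_eq (imset_inj (can_inj rK))); case: ifP.
Qed.

(** * Action of [T] on one-letter brackets and on cut words *)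

Lemma map_letters (A B : Type) (h : A -> B) (w : seq A) :
  map (map h) (letters w) = letters (map h w).
Proof. by rewrite /letters -!map_comp. Qed.

Lemma map_flatten_letters (A : Type) (w : seq (seq A)) :
  map flatten (letters w) = w.
Proof. by elim: w => //= x w ->; rewrite cats0. Qed.

Lemma T_hom_tensor_letters (D D' : tensor_scheme) (phi : scheme_hom D D')
    (f g : Mor D) :
  hom_m (T_hom phi) (tensor_letters f g) =
  tensor_letters (hom_m phi f) (hom_m phi g).
Proof.
apply: (@bracketed_diagram_eq _ _ _
  (tensor (prime_diagram (hom_m phi f)) (prime_diagram (hom_m phi g)))) => /=.
- by rewrite map_cat !map_letters !hom_dom.
- by rewrite map_cat !map_letters !hom_cod.
- exists (tensor (prime_diagram f) (prime_diagram g)).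
    exact: diagram_iso_refl.
  apply: diagram_iso_trans (relabel_tensor_iso _ _ _) _.
  by apply: tensor_iso; apply: relabel_prime_iso.
- exact: diagram_iso_refl.
Qed.

Lemma map_lp_cut (I : linear_partition) (A B : Type) (h : A -> B) (w : seq A) :
  map (map h) (lp_cut I w) = lp_cut I (map h w).
Proof. by rewrite /lp_cut -map_comp; apply: eq_map => b /=; rewrite map_mask. Qed.

(** This computes the brackets of [mu] on a cut prime diagram whose vertex has one-letter
    brackets. *)
Lemma map_flatten_lp_cut_letters (I : linear_partition) (A : Type) (w : seq A) :
  map flatten (lp_cut I (letters w)) = lp_cut I w.
Proof. by rewrite -map_lp_cut -map_comp (eq_map (@flatten_letters A)) map_id. Qed.

(** The proofs [hI'] and [hO'] are arbitrary, so that those carried by a given [fusion] term can be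
    supplied. *)
Lemma T_hom_cut_prime (D D' : tensor_scheme) (phi : scheme_hom D D')
    (I O : linear_partition) (f : Mor D)
    (hI : size (dom f) = lp_norm I) (hO : size (cod f) = lp_norm O)
    (hI' : size (dom (hom_m phi f)) = lp_norm I)
    (hO' : size (cod (hom_m phi f)) = lp_norm O) :
  hom_m (T_hom phi) (cut_prime hI hO) = cut_prime hI' hO'.
Proof.
apply: (@bracketed_diagram_eq _ _ _ (prime_diagram (hom_m phi f))) => /=.
- by rewrite map_lp_cut hom_dom.
- by rewrite map_lp_cut hom_cod.
- exists (prime_diagram f); first exact: diagram_iso_refl.
  exact: relabel_prime_iso.
- exact: diagram_iso_refl.
Qed.

(** * Cutting along a tensor product of linear partitions *)

Lemma lp_elements_tensor (I J : linear_partition) :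
  lp_elements (lp_tensor I J) =
  map inl (lp_elements I) ++ map inr (lp_elements J).
Proof.
apply: (sorted_eq (@lp_trans (lp_tensor I J)) (@lp_anti (lp_tensor I J))).
- exact/sort_sorted/lp_total.
- rewrite (sorted_pairwise (@lp_trans (lp_tensor I J))) pairwise_cat !pairwise_map.
  apply/and3P; split.
  + by apply/allrelP => _ _ /mapP[x _ ->] /mapP[y _ ->].
  + by have := sort_sorted (@lp_total I) (enum (lp_set I));
      rewrite (sorted_pairwise (@lp_trans I)).
  + by have := sort_sorted (@lp_total J) (enum (lp_set J));
      rewrite (sorted_pairwise (@lp_trans J)).
- apply: uniq_perm; first by rewrite sort_uniq enum_uniq.
    rewrite cat_uniq (map_inj_uniq inl_inj) (map_inj_uniq inr_inj).
    rewrite !sort_uniq !enum_uniq andbT.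
    by apply/hasPn => _ /mapP[y _ ->]; apply/mapP => -[].
  case=> x; rewrite mem_sort mem_enum mem_cat inE.
    by rewrite mem_map ?mem_sort ?mem_enum //; exact: inl_inj.
  by rewrite orbC mem_map ?mem_sort ?mem_enum //; exact: inr_inj.
Qed.

Lemma lp_block_nonempty (I : linear_partition) (b : {set lp_set I}) :
  b \in lp_blocks I -> exists x, x \in b.
Proof.
case/and3P: (lp_partition I) => _ _ nI bI.
by apply/set0Pn; apply: contraNneq nI => <-.
Qed.

Lemma mem_lp_block_seq (I : linear_partition) (b : {set lp_set I}) :
  (b \in lp_block_seq I) = (b \in lp_blocks I).
Proof. by rewrite mem_sort mem_enum. Qed.

(** Both lists have the same members and are sorted for the strict relation [lt], hence are equal.
    The empty set would break transitivity and irreflexivity of [lt], so both are shown on blocks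
    only. *)
Lemma lp_block_seq_tensor (I J : linear_partition) :
  lp_block_seq (lp_tensor I J) =
  [seq inl @: (b : {set lp_set I}) | b <- lp_block_seq I] ++
  [seq inr @: (b : {set lp_set J}) | b <- lp_block_seq J].
Proof.
set L := lp_tensor I J; set s := _ ++ _.
pose lt (K : linear_partition) (b b' : {set lp_set K}) :=
  [forall x in b, forall y in b', lp_le x y && (x != y)].
have ltP (K : linear_partition) (b b' : {set lp_set K}) :
    reflect (forall x y, x \in b -> y \in b' -> lp_le x y && (x != y)) (lt K b b').
  apply: (iffP forall_inP) => [H x y /H/forall_inP|H x xb]; first exact.
  by apply/forall_inP => y; apply: H.
have lt_tr : {in lp_blocks L & &, transitive (lt L)}.
  move=> b' b b'' b'L _ _ /ltP lt1 /ltP lt2; have [y yb'] := lp_block_nonempty b'L.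
  apply/ltP => x z xb zb''.
  have /andP[xy nxy] := lt1 x y xb yb'; have /andP[yz _] := lt2 y z yb' zb''.
  rewrite (lp_trans xy yz); apply: contra nxy => /eqP xz.
  by rewrite -xz in yz; apply/eqP/lp_anti; rewrite xy yz.
have lt_irr : {in lp_blocks L, irreflexive (lt L)}.
  move=> b /lp_block_nonempty[x xb]; apply/negP => /ltP /(_ x x xb xb).
  by rewrite eqxx andbF.
have sL : s =i lp_block_seq L.
  move=> b; apply: etrans (esym (@mem_lp_block_seq L b)).
  rewrite mem_cat inE; congr (_ || _); apply/mapP/imsetP => -[c cP ->];
    by exists c => //; move: cP; rewrite mem_lp_block_seq.
have mL : {subset lp_block_seq L <= lp_blocks L}.
  by move=> b; rewrite mem_lp_block_seq.
apply: (@irr_sorted_eq_in _ (lt L)).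
- by apply: sub_in3 lt_tr.
- by apply: sub_in1 lt_irr.
- exact/pairwise_sorted/lp_block_seqP.
- apply: pairwise_sorted; rewrite pairwise_cat !pairwise_map.
  apply/and3P; split.
  + apply/allrelP => _ _ /mapP[b _ ->] /mapP[c _ ->]; apply/ltP => x0 y0.
    by move=> /imsetP[x _ ->] /imsetP[y _ ->].
  + apply: sub_pairwise (lp_block_seqP I) => b c /ltP H /=; apply/ltP => x0 y0.
    by move=> /imsetP[x xb ->] /imsetP[y yc ->]; rewrite /= (inj_eq inl_inj) H.
  + apply: sub_pairwise (lp_block_seqP J) => b c /ltP H /=; apply/ltP => x0 y0.
    by move=> /imsetP[x xb ->] /imsetP[y yc ->]; rewrite /= (inj_eq inr_inj) H.
- by move=> b; rewrite sL.
Qed.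

Lemma mask_map_false (A B : Type) (s : seq A) (w : seq B) :
  mask [seq false | _ <- s] w = [::].
Proof. by elim: s w => [|x s IH] [|y w] /=. Qed.

Lemma lp_cut_tensor (I J : linear_partition) (A : Type) (w w' : seq A) :
  size w = lp_norm I -> size w' = lp_norm J ->
  lp_cut (lp_tensor I J) (w ++ w') = lp_cut I w ++ lp_cut J w'.
Proof.
have sE (K : linear_partition) : size (lp_elements K) = lp_norm K.
  by rewrite size_sort -cardE.
move=> sw sw'; rewrite /lp_cut lp_elements_tensor lp_block_seq_tensor map_cat.
rewrite -!map_comp; congr (_ ++ _); apply: eq_map => b /=;
  rewrite map_cat mask_cat ?size_map ?sE // -!map_comp.
(* A block [inl @: b] contains no [inr y], so its mask is false all along [w']. *)
- rewrite [X in mask X w'](eq_map (g := fun=> false)) => [|y /=]; last first.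
    by apply/imsetP => -[].
  rewrite mask_map_false cats0; congr (mask _ w).
  by apply: eq_map => x /=; rewrite (mem_imset _ _ inl_inj).
- rewrite [X in mask X w ++ _](eq_map (g := fun=> false)) => [|y /=]; last first.
    by apply/imsetP => -[].
  rewrite mask_map_false cat0s; congr (mask _ w').
  by apply: eq_map => x /=; rewrite (mem_imset _ _ inr_inj).
Qed.

Theorem proposition6p2p5 (M : tensor_manifold) (f g : Mor M)
    (I1 O1 I2 O2 : linear_partition)
    (hI1 : size (dom f) = lp_norm I1) (hO1 : size (cod f) = lp_norm O1)
    (hI2 : size (dom g) = lp_norm I2) (hO2 : size (cod g) = lp_norm O2) :
  @fusion M (lp_tensor I1 I2) (lp_tensor O1 O2) (tensor_eps f g)
      (tensor_eps_dom_norm hI1 hI2) (tensor_eps_cod_norm hO1 hO2) =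
  tensor_eps (@fusion M I1 O1 f hI1 hO1) (@fusion M I2 O2 g hI2 hO2).
Proof.
have hI : size (dom (tensor_letters f g)) = lp_norm (lp_tensor I1 I2).
  by rewrite /= size_cat !size_letters lp_tensor_norm hI1 hI2.
have hO : size (cod (tensor_letters f g)) = lp_norm (lp_tensor O1 O2).
  by rewrite /= size_cat !size_letters lp_tensor_norm hO1 hO2.
pose F1 := cut_prime hI1 hO1; pose F2 := cut_prime hI2 hO2.
pose G := tensor (prime_diagram f) (prime_diagram g).
have w0 : 0 < size (dom F1 ++ dom F2) by rewrite size_cat ltn_addr // dom_nonempty.
have u0 : 0 < size (cod F1 ++ cod F2) by rewrite size_cat ltn_addr // cod_nonempty.
have Gd : gdom G = flatten (dom F1 ++ dom F2).
  by rewrite tensor_prime_gdom !flatten_cat !flatten_letters !flatten_lp_cut.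
have Gc : gcod G = flatten (cod F1 ++ cod F2).
  by rewrite tensor_prime_gcod !flatten_cat !flatten_letters !flatten_lp_cut.
pose Y := bracket w0 u0
  (tensor_diagram (prime_diagram_ok f) (prime_diagram_ok g)) Gd Gc.
transitivity (hom_m (eps M) Y).
(* [T eps] replaces the vertex [tensor_letters f g] by its image under [eps], which is
   [tensor_eps f g] by definition. *)
- rewrite -(@eps_assoc_m M (cut_prime hI hO) Y).
    by rewrite (T_hom_cut_prime _ _ (tensor_eps_dom_norm hI1 hI2)
                                    (tensor_eps_cod_norm hO1 hO2)).
  split.
  + by rewrite /= -lp_cut_tensor // -map_flatten_lp_cut_letters /letters map_cat.
  + by rewrite /= -lp_cut_tensor // -map_flatten_lp_cut_letters /letters map_cat.
  + exists (prime_diagram (tensor_letters f g)), G; split.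
    * exact: diagram_iso_refl.
    * exact: diagram_iso_refl.
    (* A prime diagram takes as value any representative of its vertex, here [G]. *)
    * by apply: value_prime; apply: diagram_iso_refl.
(* [T eps] turns the vertices [F1] and [F2] into the two fusions. *)
- rewrite -(@eps_assoc_m M (tensor_letters F1 F2) Y).
    by rewrite T_hom_tensor_letters.
  split.
  (* Each outer bracket holds a single word of [F1] or [F2], so concatenation restores the cuts. *)
  + by rewrite /= map_cat !map_flatten_letters.
  + by rewrite /= map_cat !map_flatten_letters.
  + exists (tensor (prime_diagram F1) (prime_diagram F2)), G; split.
    * exact: diagram_iso_refl.
    * exact: diagram_iso_refl.
    * by apply: value_tensor; apply: value_prime; apply: diagram_iso_refl.
Qed.
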